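(* Assume that $\Omega$ is contained in a Cartesian box $D\subset\mathbb{R}^d$ and that $\mu$ is a probability measure supported on $\Omega$. Suppose that, for some tensor-product Bernstein polyellipse $\mathcal E_\varrho(D)$ with $\varrho>1$, the map $\xi\mapsto k_L(\xi,\mathbf{x}')$ is analytic on $\mathcal E_\varrho(D)$ (i.e. extends analytically there) for every $\mathbf{x}'\in\Omega$ and, for some $C_k>0$, satisfies $$\sup_{\xi\in\mathcal E_\varrho(D),\ \mathbf{x}'\in\Omega}|k_L(\xi,\mathbf{x}')|\le C_k.$$ Then there are constants $C_1\ge\tau_1$ and $c_1>0$, depending on $(C_k,\varrho,D,d)$, such that $$\tau_j\le C_1e^{-c_1j^{1/d}},\qquad j\ge1.$$
   Context: Let $\Omega\subset\mathbb{R}^d$ be a bounded domain, $L$ a linear differential operator, and $H=L^2(\mu)$. Random features are $\varphi(\mathbf{x};\theta)=\sigma(w\cdot\mathbf{x}+b_\theta)$ with activation function $\sigma$ and parameter $\theta=(w,b_\theta)\in\mathbb{R}^d\times\mathbb{R}$ drawn from a law $\rho$. Write $\zeta_\theta(\mathbf{x})=(L\varphi)(\mathbf{x};\theta)$. Standing assumptions: $\rho$ has bounded support; the required derivatives of $\sigma$ are bounded on the corresponding compact affine image of $\Omega$; and $R_\zeta:=\sup_{\theta\in\operatorname{supp}(\rho)}\|\zeta_\theta\|_H^2<\infty$. The residual kernel and its integral operator on $H$ are $$k_L(\mathbf{x},\mathbf{x}')=\mathbb{E}_{\theta\sim\rho}[\zeta_\theta(\mathbf{x})\zeta_\theta(\mathbf{x}')],\qquad(\mathcal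 T v)(\mathbf{x})=\int_\Omega k_L(\mathbf{x},\mathbf{x}')v(\mathbf{x}')\,d\mu(\mathbf{x}').$$ $\mathcal T$ is self-adjoint, positive semidefinite and trace-class, with eigenvalues $\tau_1\ge\tau_2\ge\cdots\ge0$ (counted with multiplicity, padded by zeros if necessary); assume $\mathcal T\neq0$. For a box $D=\prod_{i=1}^d[a_i,b_i]$, the tensor-product Bernstein polyellipse $\mathcal E_\varrho(D)\subset\mathbb{C}^d$ is the product over $i$ of the images of the Bernstein ellipse region $\{(z+z^{-1})/2:\ 1\le|z|<\varrho\}\subset\mathbb{C}$ under the affine map taking $[-1,1]$ to $[a_i,b_i]$. *)

(* Defs.v *)
From HB Require Import structures.
From mathcomp Require Import all_boot all_order all_algebra.
From mathcomp Require Import complex.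
From mathcomp Require Import all_classical all_reals all_analysis.

Set Implicit Arguments.
Unset Strict Implicit.
Unset Printing Implicit Defensive.
Import Order.TTheory GRing.Theory Num.Theory.
Import numFieldNormedType.Exports.
Import ComplexField.Normc.

Local Open Scope classical_set_scope.
Local Open Scope ring_scope.

Notation borel T := (g_sigma_algebraType (@open T)).

Definition box (R : realType) (d : nat) (a b : 'rV[R]_d) : set 'rV[R]_d :=
  [set x | forall i, a 0 i <= x 0 i <= b 0 i].

(* The parameter space; theta = (w, b). *)
Notation params R d := ('rV[R]_d * R)%type.

Definition law_support (R : realType) (d : nat)
    (rho : probability (borel (params R d)) R) : set (params R d) :=
  [set theta | forall U : set (params R d), open U -> U theta ->
     (0 < rho U)%E].

Definition affine (R : realType) (d : nat) (theta : params R d)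
    (x : 'rV[R]_d) : R :=
  (\sum_i theta.1 0 i * x 0 i) + theta.2.

Definition feature (R : realType) (d : nat) (sigma : R -> R)
    (theta : params R d) (x : 'rV[R]_d) : R :=
  sigma (affine theta x).

Definition partial (R : realType) (d : nat) (i : 'I_d)
    (u : 'rV[R]_d -> R) : 'rV[R]_d -> R :=
  fun x => 'D_(delta_mx 0 i) u x.

Definition mpartial (R : realType) (d : nat) (alpha : 'I_d -> nat)
    (u : 'rV[R]_d -> R) : 'rV[R]_d -> R :=
  foldr (fun i g => iter (alpha i) (partial i) g) u (enum 'I_d).

(* The order-m operator  u |-> sum_(|alpha| <= m) c_alpha d^alpha u.  The
   values of c at the indices with |alpha| > m play no role. *)
Definition diff_op (R : realType) (d m : nat)
    (c : {ffun 'I_d -> 'I_m.+1} -> 'rV[R]_d -> R)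
    (u : 'rV[R]_d -> R) (x : 'rV[R]_d) : R :=
  \sum_(alpha : {ffun 'I_d -> 'I_m.+1} | (\sum_i alpha i <= m)%N)
    c alpha x * mpartial (fun i => alpha i : nat) u x.

Definition zeta (R : realType) (d m : nat)
    (c : {ffun 'I_d -> 'I_m.+1} -> 'rV[R]_d -> R) (sigma : R -> R)
    (theta : params R d) : 'rV[R]_d -> R :=
  diff_op c (feature sigma theta).

(* The set of all w.x + b with (w, b) in supp rho and x in the closure of
   Omega; it is compact when Omega and supp rho are bounded. *)
Definition affine_image (R : realType) (d : nat) (Omega : set 'rV[R]_d)
    (rho : probability (borel (params R d)) R) : set R :=
  [set affine theta x | theta in law_support rho & x in closure Omega].

Definition residual_kernel (R : realType) (d m : nat)
    (c : {ffun 'I_d -> 'I_m.+1} -> 'rV[R]_d -> R) (sigma : R -> R)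
    (rho : probability (borel (params R d)) R) (x x' : 'rV[R]_d) : R :=
  fine ('E_rho[fun theta => (zeta c sigma theta x * zeta c sigma theta x')%R]).

Definition integral_op (R : realType) (d : nat) (Omega : set 'rV[R]_d)
    (mu : probability (borel 'rV[R]_d) R) (k : 'rV[R]_d -> 'rV[R]_d -> R)
    (v : 'rV[R]_d -> R) (x : 'rV[R]_d) : R :=
  \int[mu]_(x' in Omega) (k x x' * v x').

Section spectrum.
Context (disp : measure_display) (X : measurableType disp) (R : realType).
Variable mu : {measure set X -> \bar R}.

(* L^2(mu) is represented by square-integrable functions, with equality
   mu-almost everywhere. *)
Definition in_eigenspace (T : (X -> R) -> X -> R) (l : R) (v : X -> R) : Prop :=
  v \in Lfun mu 2%:E /\ T v = (fun x => l * v x) %[ae mu].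

Definition eigenbasis (T : (X -> R) -> X -> R) (l : R) (n : nat)
    (v : 'I_n -> X -> R) : Prop :=
  [/\ forall i, in_eigenspace T l (v i),
      forall s : 'I_n -> R,
        (fun x => \sum_i s i * v i x) = cst 0 %[ae mu] -> forall i, s i = 0
    & forall u, in_eigenspace T l u ->
        exists s : 'I_n -> R, u = (fun x => \sum_i s i * v i x) %[ae mu] ].

(* tau 0 >= tau 1 >= ... >= 0 lists the eigenvalues of T: every nonzero l
   occurs in it exactly dim ker (T - l) times (0 times when l is not an
   eigenvalue), and the remaining entries are 0. *)
Definition eigenvalue_seq (T : (X -> R) -> X -> R) (tau : R^nat) : Prop :=
  [/\ nonincreasing_seq tau,
      forall j, 0 <= tau j
    & forall l, l != 0 -> exists (n : nat) (v : 'I_n -> X -> R),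
        eigenbasis T l v /\ ([set j | tau j = l] #= `I_n)%card ].

End spectrum.

Section complex_analysis.
Context (R : realType) (d : nat).
Local Open Scope complex_scope.

Definition mmonomial (alpha : {ffun 'I_d -> nat}) (z : 'rV[R[i]]_d) : R[i] :=
  \prod_i z 0 i ^+ alpha i.

Definition nat_index (N : nat) (alpha : {ffun 'I_d -> 'I_N}) :
  {ffun 'I_d -> nat} := [ffun i => alpha i : nat].

(* On a polydisc around p, f is the sum of an absolutely convergent power
   series in d complex variables; partial sums run over the cubes
   {0, ..., N - 1}^d of multi-indices. *)
Definition analytic_at (f : 'rV[R[i]]_d -> R[i]) (p : 'rV[R[i]]_d) : Prop :=
  exists (r : R) (coef : {ffun 'I_d -> nat} -> R[i]), 0 < r /\
    forall z : 'rV[R[i]]_d, (forall i, normc (z 0 i - p 0 i) < r) ->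
      (exists M : R, forall N, \sum_(alpha : {ffun 'I_d -> 'I_N})
         normc (coef (nat_index alpha) * mmonomial (nat_index alpha) (z - p))
           <= M) /\
      (fun N => normc (\sum_(alpha : {ffun 'I_d -> 'I_N})
         coef (nat_index alpha) * mmonomial (nat_index alpha) (z - p) - f z))
         @ \oo --> (0 : R).

Definition bernstein_ellipse (r : R) : set R[i] :=
  [set (z + z^-1) / 2 | z in [set z : R[i] | 1 <= normc z < r]].

Definition polyellipse (a b : 'rV[R]_d) (r : R) : set 'rV[R[i]]_d :=
  [set xi | forall i, exists2 z, bernstein_ellipse r z &
     xi 0 i = ((a 0 i + b 0 i) / 2)%:C + ((b 0 i - a 0 i) / 2)%:C * z].

(* The second clause says that f extends g from Omega, viewed inside C^d. *)
Definition bounded_analytic_extension (Omega : set 'rV[R]_d)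
    (E : set 'rV[R[i]]_d) (C : R) (g : 'rV[R]_d -> R) : Prop :=
  exists f : 'rV[R[i]]_d -> R[i],
    [/\ forall xi, E xi -> analytic_at f xi,
        forall x, Omega x -> f (map_mx (real_complex R) x) = (g x)%:C
      & forall xi, E xi -> normc (f xi) <= C].

End complex_analysis.

(* Main.v *)
Require Import Defs.
From mathcomp Require Import all_boot all_order all_algebra.
From mathcomp Require Import complex.
From mathcomp Require Import all_classical all_reals all_analysis.
From mathcomp Require Import measurable_realfun.
From mathcomp Require Import cyclic separable cyclotomic.
From mathcomp Require Import ring lra.

Set Implicit Arguments.
Unset Strict Implicit.
Unset Printing Implicit Defensive.
Import Order.TTheory GRing.Theory Num.Theory.
Import numFieldNormedType.Exports.
Import ComplexField.Normc.

Local Open Scope classical_set_scope.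
Local Open Scope ring_scope.

(** The residual kernel [k] is symmetric, and the polyellipse forces [k x y]
    to be close, uniformly on [Omega], to finite sums
    [\sum_p s_p(y) f_p(x)] in which the number of functions [f_p] grows only
    like [N ^ d] for an error [2 ^- N].  A self-adjoint operator whose kernel
    has such an approximation with [n] functions cannot have [n + 1]
    eigenvalues above the error, and [N] of the order of [j ^ (1/d)] gives the
    announced rate.

    _Approximation._  Every point of the box lies in the polyellipse together
    with a polydisc whose radii are a fixed proportion of the sides of the box,
    depending on [r] only ([polyellipse_near]).  Hence the box is cut into
    [M.+1 ^ d] half-open cells, [M] depending on [r] only, and on each cell the
    analytic extension is replaced by its Taylor polynomial at the lower corner
    of the cell ([cell_approximation]).  The Taylor remainder is bounded along
    complex lines: for a bounded analytic function [g] of one variable in the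
    disc of radius [rho], the successive quotients
    [h_(n+1)(t) = (h_n(t) - h_n(0)) / t], [h_0 = g], satisfy
    [|h_n| <= B (2 / rho)^n] by the maximum principle, as in the Schwarz lemma
    ([iterated_schwarz], [taylor_remainder_on_line]).  The maximum principle
    itself only uses that an analytic function is, near each point, a uniform
    limit of polynomials, and that the value of a polynomial at the centre of a
    circle is the mean of its values over sufficiently many equidistant points
    of the circle ([maximum_principle]).  No contour integral is involved.

    _Spectral part._  With one monomial per cell and a fine mesh, the same
    approximation shows that [k] is a uniform limit of sums
    [\sum_i u_i(x) k(w_i, y)] with measurable factors
    ([kernel_step_approximation]).  This yields the measurability of the
    sections of [k], and the symmetry of the operator without a double
    integral, so eigenfunctions of distinct eigenvalues are orthogonal
    ([eigenvectors_orthogonal]).  Among the combinations [v] of [n + 1]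
    eigenfunctions one is orthogonal to [n] prescribed functions [f_p]; the
    operator then sends [v] to a function bounded by the error times the norm
    of [v], while it expands the norm of [v] by at least the smallest of the
    [n + 1] eigenvalues ([eigenvalue_le_approximation]). *)

(** * The modulus of complex numbers and roots of unity *)

Section modulus.
Variable R : realType.
Implicit Types z w : R[i].

Lemma normc_ge0 z : 0 <= normc z.
Proof. by case: z => x y; exact: sqrtr_ge0. Qed.

Lemma normc_gt0 z : z != 0 -> 0 < normc z.
Proof.
move=> z0; rewrite lt_def normc_ge0 andbT.
by apply: contra z0 => /eqP/eq0_normc ->.
Qed.

Lemma normc_add z w : normc (z + w) <= normc z + normc w.
Proof. exact: le_normcD. Qed.

Lemma normc_opp z : normc (- z) = normc z.
Proof. exact: normcN. Qed.

Lemma normc_distC z w : normc (z - w) = normc (w - z).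
Proof. by rewrite -normc_opp opprB. Qed.

Lemma normc_real (x : R) : normc x%:C%C = `|x|.
Proof. by rewrite /= expr0n addr0 sqrtr_sqr. Qed.

Lemma normc_sqr z : normc z ^+ 2 = complex.Re z ^+ 2 + complex.Im z ^+ 2.
Proof. by case: z => x y /=; rewrite sqr_sqrtr// addr_ge0 ?sqr_ge0. Qed.

Lemma normc_exp z n : normc (z ^+ n) = normc z ^+ n.
Proof. by elim: n => [|n ih]; rewrite ?normc1// !exprS normcM ih. Qed.

Lemma normc_sum (I : Type) (s : seq I) (P : pred I) (F : I -> R[i]) :
  normc (\sum_(i <- s | P i) F i) <= \sum_(i <- s | P i) normc (F i).
Proof.
elim/big_ind2 : _ => [|x a y b xa yb|//]; first by rewrite normc0.
by rewrite (le_trans (normc_add _ _))// lerD.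
Qed.

Lemma Re_le_normc z : `|complex.Re z| <= normc z.
Proof.
by rewrite -ler_sqr ?nnegrE ?normc_ge0// normc_sqr real_normK ?num_real// lerDl sqr_ge0.
Qed.

Lemma normc_le_Re_Im z : normc z <= `|complex.Re z| + `|complex.Im z|.
Proof.
rewrite -ler_sqr ?nnegrE ?normc_ge0 ?addr_ge0// normc_sqr sqrrD.
by rewrite !real_normK ?num_real// lerD2r lerDl mulrn_wge0// mulr_ge0.
Qed.

End modulus.

Lemma prim_root_exists (F : numClosedFieldType) (n : nat) :
  (0 < n)%N -> exists z : F, n.-primitive_root z.
Proof.
pose p : {poly F} := 'X^n - 1; have [s Dp] := closed_field_poly_normal p.
move=> n_gt0; rewrite (monicP _) ?monicXnsubC // scale1r in Dp.
have sn1 : all n.-unity_root s by apply/allP=> z; rewrite -root_prod_XsubC -Dp.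
have sz_s : (n < (size s).+1)%N.
  by rewrite -(size_prod_XsubC s id) -Dp size_XnsubC.
have [|z _ zn] := hasP (has_prim_root n_gt0 sn1 _ sz_s); last by exists z.
by rewrite -separable_prod_XsubC -Dp separable_Xn_sub_1 // pnatr_eq0 -lt0n.
Qed.

Lemma sum_prim_root (F : fieldType) (n j : nat) (w : F) :
  n.-primitive_root w -> (0 < j < n)%N -> \sum_(k < n) (w ^+ k) ^+ j = 0.
Proof.
move=> wn /andP[j0 jn].
have wj1 : w ^+ j != 1.
  rewrite -(prim_order_dvd wn); apply/negP => /dvdn_leq; rewrite j0 => /(_ isT).
  by rewrite leqNgt jn.
apply: (mulfI (_ : w ^+ j - 1 != 0)); first by rewrite subr_eq0.
under eq_bigr do rewrite exprAC.
by rewrite -subrX1 exprAC (prim_expr_order wn) expr1n subrr mulr0.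
Qed.

(** In the Taylor expansion of [q] at [p] every power [0 < j < n] of the
    increment averages to zero over the [n]-th roots of unity. *)
Lemma poly_mean (F : fieldType) (n : nat) (w : F) (q : {poly F}) (p t : F) :
  n.-primitive_root w -> (size q <= n)%N ->
  \sum_(k < n) q.[p + t * w ^+ k] = q.[p] *+ n.
Proof.
move=> wn qn.
under eq_bigr do rewrite (nderiv_taylor_wide (mulrC _ _) qn).
have n0 := prim_order_gt0 wn.
rewrite exchange_big/= (bigD1 (Ordinal n0))//= [X in _ + X]big1 ?addr0.
  rewrite (eq_bigr (fun=> q.[p])) ?sumr_const ?card_ord// => k _.
  by rewrite /= expr0 mulr1 nderivn0.
move=> [[|j] jn]//= _.
under eq_bigr do rewrite exprMn mulrA.
by rewrite -mulr_sumr sum_prim_root ?mulr0.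
Qed.

(** * Functions that are locally uniform limits of polynomials *)

Lemma half_pow_small (R : realType) (c e : R) :
  0 < e -> exists n, c * 2 ^- n <= e.
Proof.
move=> e0; exists (Num.bound (c / e)).
rewrite ler_pdivrMr ?exprn_gt0// mulrC -ler_pdivrMr//.
exact: ltW (upper_nthrootP (leqnn _)).
Qed.
Lemma normc_prim_root (R : realType) (n : nat) (w : R[i]) :
  n.-primitive_root w -> normc w = 1.
Proof.
move=> wn; apply: (@pexpIrn _ n); rewrite ?nnegrE ?normc_ge0 ?(prim_order_gt0 wn)//.
by rewrite -normc_exp (prim_expr_order wn) expr1n normc1.
Qed.

Lemma mean_sqr_circle (R : realType) (n : nat) (w p : R[i]) (r : R) :
  n.-primitive_root w -> (1 < n)%N ->
  \sum_(k < n) normc (p + r%:C%C * w ^+ k) ^+ 2 = (normc p ^+ 2 + r ^+ 2) *+ n.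
Proof.
move=> wn n1.
have w0 : \sum_(k < n) w ^+ k = 0.
  by have := @sum_prim_root _ _ 1%N _ wn n1; under eq_bigr do rewrite expr1.
have expand z : normc (p + r%:C%C * z) ^+ 2 = normc p ^+ 2 + r ^+ 2 * normc z ^+ 2
    + (2 * r * complex.Re p * complex.Re z + 2 * r * complex.Im p * complex.Im z).
  by rewrite !normc_sqr; case: p z => [p1 p2] [z1 z2] /=; ring.
under eq_bigr do rewrite expand normc_exp (normc_prim_root wn) !expr1n mulr1.
rewrite big_split/= sumr_const card_ord big_split/= -!mulr_sumr.
by rewrite -!raddf_sum/= w0 /= !mulr0 !addr0.
Qed.

Section polynomial_approximation.
Variable R : realType.
Implicit Types (h g : R[i] -> R[i]) (p z : R[i]) (q : {poly R[i]}).

(** The substitute for analyticity in one variable: it is stable under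
    products and under division by [z] away from [0], and it suffices for the
    maximum principle. *)
Definition poly_approx h p := exists2 r : R, 0 < r &
  forall e, 0 < e -> exists q, forall z, normc (z - p) <= r ->
    normc (h z - q.[z]) <= e.

Lemma poly_lipschitz q (B : R) : exists2 L, 0 <= L &
  forall z w, normc z <= B -> normc w <= B ->
    normc q.[z] <= L /\ normc (q.[z] - q.[w]) <= L * normc (z - w).
Proof.
elim/poly_ind : q => [|q c [L L0 qL]].
  by exists 0 => // z w _ _; rewrite !horner0 subr0 normc0 mul0r.
exists (L * `|B| + L + normc c).
  by rewrite !addr_ge0// ?mulr_ge0// normc_ge0.
move=> z w zB wB; have [q1 q2] := qL _ _ zB wB.
have B0 : 0 <= B := le_trans (normc_ge0 _) zB.
rewrite ger0_norm// !hornerMXaddC; split.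
  rewrite (le_trans (normc_add _ _))// lerD2r normcM.
  by rewrite (@le_trans _ _ (L * B))// ?lerDl// ler_pM// normc_ge0.
rewrite (_ : _ - _ = q.[z] * (z - w) + (q.[z] - q.[w]) * w); last by ring.
rewrite (le_trans (normc_add _ _))// !normcM !mulrDl.
have := normc_ge0 (z - w); set t := normc (z - w) in q2 *; move=> t0.
rewrite ler_wpDr//; first by rewrite mulr_ge0// normc_ge0.
rewrite addrC lerD ?ler_wpM2r// mulrAC ler_pM//; exact: normc_ge0.
Qed.

Lemma poly_approx_continuous h p : poly_approx h p ->
  forall e, 0 < e -> exists2 d : R, 0 < d &
    forall z, normc (z - p) < d -> normc (h z - h p) < e.
Proof.
move=> [r r0 happrox] e e0.
have [|q hq] := happrox (e / 4); first by rewrite divr_gt0.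
have [L L0 qL] := poly_lipschitz q (normc p + r).
exists (Num.min r (e / (4 * (L + 1)))).
  by rewrite lt_min r0 divr_gt0// mulr_gt0// ltr_pwDr.
move=> z; rewrite lt_min => /andP[zr ze].
have zB : normc z <= normc p + r.
  rewrite -[z](subrK p) addrC (le_trans (normc_add _ _))// lerD2l//; exact: ltW.
have pB : normc p <= normc p + r by rewrite lerDl ltW.
have [_ qzp] := qL _ _ zB pB.
have hz := hq z (ltW zr).
have hp : normc (h p - q.[p]) <= e / 4 by apply: hq; rewrite subrr normc0 ltW.
rewrite (_ : _ - _ = (h z - q.[z]) + (q.[z] - q.[p]) - (h p - q.[p])); last by ring.
have := normc_add ((h z - q.[z]) + (q.[z] - q.[p])) (- (h p - q.[p])).
have := normc_add (h z - q.[z]) (q.[z] - q.[p]).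
rewrite normc_opp.
have L1 : 0 < L + 1 by rewrite ltr_pwDr.
have Le : L * normc (z - p) <= e / 4.
  have ze4 : normc (z - p) * (4 * (L + 1)) < e by rewrite -ltr_pdivlMr// mulr_gt0.
  rewrite ler_pdivlMr// (le_trans _ (ltW ze4))//.
  rewrite (_ : _ * 4 = normc (z - p) * (4 * L)); last by ring.
  by rewrite ler_wpM2l ?normc_ge0// ler_wpM2l// lerDl.
lra.
Qed.

Lemma poly_approx_poly q p : poly_approx (horner q) p.
Proof.
exists 1 => // e e0; exists q => z _; rewrite subrr normc0; exact: ltW.
Qed.

Lemma poly_approx_add h g p :
  poly_approx h p -> poly_approx g p -> poly_approx (fun z => h z + g z) p.
Proof.
move=> [r r0 hr] [s s0 gs]; exists (Num.min r s); first by rewrite lt_min r0.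
move=> e e0; have e20 : 0 < e / 2 by rewrite divr_gt0.
have [q hq] := hr _ e20; have [t gt] := gs _ e20.
exists (q + t) => z; rewrite le_min => /andP[zr zs].
rewrite hornerD opprD addrACA (le_trans (normc_add _ _))//.
by rewrite [e in _ <= e]splitr lerD// (hq, gt).
Qed.

Lemma poly_approx_mul h g p :
  poly_approx h p -> poly_approx g p -> poly_approx (fun z => h z * g z) p.
Proof.
move=> [r r0 hr] [s s0 gs]; pose t := Num.min r s.
have t0 : 0 < t by rewrite lt_min r0.
have [q1 hq1] := hr 1 ltr01; have [L1 L10 q1L] := poly_lipschitz q1 (normc p + t).
have [q2 gq2] := gs 1 ltr01; have [L2 L20 q2L] := poly_lipschitz q2 (normc p + t).
exists t => // e e0.
have D1 : 0 < L1 + L2 + 3 by rewrite ltr_wpDl ?addr_ge0.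
pose d := Num.min 1 (e / (L1 + L2 + 3)).
have d0 : 0 < d by rewrite lt_min ltr01 divr_gt0.
have [q hq] := hr _ d0; have [u gu] := gs _ d0.
exists (q * u) => z zt.
have zB : normc z <= normc p + t.
  by rewrite -[z](subrK p) addrC (le_trans (normc_add _ _))// lerD2l.
move: zt; rewrite le_min => /andP[zr zs].
have [hL _] := q1L _ _ zB zB; have [gL _] := q2L _ _ zB zB.
have {}hq1 := hq1 _ zr; have {}gq2 := gq2 _ zs.
have {}hq := hq _ zr; have {}gu := gu _ zs.
rewrite hornerM.
rewrite (_ : _ - _ = (h z - q.[z]) * g z + h z * (g z - u.[z])
   - (h z - q.[z]) * (g z - u.[z])); last by ring.
have gz : normc (g z) <= L2 + 1.
  by have := normc_add (g z - q2.[z]) q2.[z]; rewrite subrK; lra.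
have hz : normc (h z) <= L1 + 1.
  by have := normc_add (h z - q1.[z]) q1.[z]; rewrite subrK; lra.
have d1 : d <= 1 by rewrite ge_min lexx.
have de : d * (L1 + L2 + 3) <= e by rewrite -ler_pdivlMr// ge_min lexx orbT.
apply: le_trans de.
rewrite (le_trans (normc_add _ _))// normc_opp.
rewrite (le_trans (lerD (normc_add _ _) (lexx _)))// !normcM.
have -> : d * (L1 + L2 + 3) = d * (L2 + 1) + (L1 + 1) * d + d * 1 by ring.
by rewrite !lerD// ler_pM ?normc_ge0// (le_trans gu).
Qed.

(** The geometric series of [z^-1] around [p] converges uniformly on the disc
    of radius [normc p / 2]. *)
Lemma poly_approx_inv p : p != 0 -> poly_approx (fun z => z^-1) p.
Proof.
move=> p0.
have np0 := normc_gt0 p0.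
exists (normc p / 2); first by rewrite divr_gt0.
move=> e e0; have [n hn] := half_pow_small (2 / normc p) e0.
pose x z : R[i] := (p - z) / p.
exists (\sum_(k < n) p^-1 *: (p^-1 *: (p%:P - 'X)) ^+ k) => z zp.
have xE : (\sum_(k < n) p^-1 *: (p^-1 *: (p%:P - 'X)) ^+ k).[z]
    = p^-1 * \sum_(k < n) x z ^+ k.
  rewrite horner_sum mulr_sumr; apply: eq_bigr => k _.
  rewrite hornerZ horner_exp hornerZ hornerD hornerN hornerX hornerC /x.
  by rewrite [in RHS]mulrC [(p - z) / p]mulrC [in RHS]mulrC.
have nz : normc p / 2 <= normc z.
  have := normc_add (p - z) z; rewrite subrK normc_distC => *; lra.
have z0 : z != 0.
  by apply: contraTneq nz => ->; rewrite normc0 -ltNge divr_gt0.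
have -> : z^-1 - (\sum_(k < n) p^-1 *: (p^-1 *: (p%:P - 'X)) ^+ k).[z] = x z ^+ n / z.
  have xz : x z - 1 = - z / p by rewrite /x; field.
  have := subrX1 (x z) n; rewrite xE xz.
  set S := \sum_(k < n) _ => xS.
  have -> : x z ^+ n = 1 - z / p * S by rewrite -mulNr -mulNr -xS; ring.
  by field; rewrite z0.
rewrite normcM normc_exp normcM !normcV normc_distC.
have xh : normc (z - p) / normc p <= 2^-1 by rewrite ler_pdivrMr// mulrC.
rewrite mulrC (le_trans _ hn)// -exprVn.
have zV : (normc z)^-1 <= 2 / normc p.
  by rewrite -[2 / _]invf_div lef_pV2// posrE ?(lt_le_trans _ nz) ?divr_gt0.
apply: ler_pM zV _; rewrite ?exprn_ge0 ?invr_ge0 ?divr_ge0 ?normc_ge0//.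
by rewrite lerXn2r// ?nnegrE ?divr_ge0 ?normc_ge0.
Qed.

End polynomial_approximation.
(** * The maximum principle and the iterated Schwarz lemma *)

Section maximum_principle.
Variable R : realType.
Implicit Types (h : R[i] -> R[i]) (p z : R[i]).

Let disc (rho : R) : set (R * R) := [set xy | normc (xy.1 +i* xy.2)%C <= rho].

Lemma normc_continuous : continuous (fun xy : R * R => normc (xy.1 +i* xy.2)%C).
Proof.
move=> xy; apply: (@continuous_comp _ _ _
  (fun xy : R * R => xy.1 ^+ 2 + xy.2 ^+ 2) Num.sqrt).
  apply: cvgD; (rewrite expr2; under eq_fun do rewrite expr2);
    apply: cvgM; (exact: cvg_fst || exact: cvg_snd).
exact: sqrt_continuous.
Qed.

Lemma disc_compact (rho : R) : compact (disc rho).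
Proof.
apply: (@subclosed_compact _ _ (`[- rho, rho] `*` `[- rho, rho])).
- apply: (@closed_comp _ _ _ [set x : R | x <= rho]).
    by move=> xy _; exact: normc_continuous.
  exact: closed_le.
- by apply: compact_setX; exact: segment_compact.
- move=> [x y] /= xyr; split; rewrite /= in_itv/= -ler_norml.
    exact: le_trans (Re_le_normc (x +i* y)%C) xyr.
  apply: le_trans xyr; rewrite -ler_sqr ?nnegrE ?normc_ge0// normc_sqr/=.
  by rewrite real_normK ?num_real// lerDr sqr_ge0.
Qed.

(** For [e > 0] the term [e * normc z ^+ 2] is what excludes interior maximizers
    in the maximum principle: its means over small circles strictly exceed its
    value at the centre. *)
Lemma poly_approx_max h (rho e : R) : 0 <= rho ->
  (forall p, normc p <= rho -> poly_approx h p) ->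
  exists2 p, normc p <= rho &
    forall z, normc z <= rho ->
      normc (h z) + e * normc z ^+ 2 <= normc (h p) + e * normc p ^+ 2.
Proof.
move=> rho0 happ.
pose f (xy : R * R) := normc (h (xy.1 +i* xy.2)%C) + e * normc (xy.1 +i* xy.2)%C ^+ 2.
have [] := @compact_EVT_max _ _ f (disc rho).
- by exists (0, 0); rewrite /disc/= expr0n/= addr0 sqrtr0.
- exact: disc_compact.
- apply: continuous_in_subspaceT => xy /set_mem xyrho.
  apply: cvgD; last first.
    by apply: cvgM; [exact: cvg_cst|apply: cvgM; exact: normc_continuous].
  apply/cvgrPdist_lt => d d0.
  have [c c0 hc] := poly_approx_continuous (happ _ xyrho) d0.
  have c20 : 0 < c / 2 by rewrite divr_gt0.
  have /cvgrPdist_lt/(_ _ c20) near1 : xy'.1 @[xy' --> xy] --> xy.1 by exact: cvg_fst.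
  have /cvgrPdist_lt/(_ _ c20) near2 : xy'.2 @[xy' --> xy] --> xy.2 by exact: cvg_snd.
  near=> xy'.
  set z' := (xy'.1 +i* xy'.2)%C; set z := (xy.1 +i* xy.2)%C.
  have zz' : normc (z' - z) < c.
    rewrite (le_lt_trans (normc_le_Re_Im _))//= [c]splitr ltrD//.
      by rewrite distrC; near: xy'.
    by rewrite distrC; near: xy'.
  have := hc _ zz'; have := normc_add (h z' - h z) (h z).
  have := normc_add (h z - h z') (h z'); rewrite !subrK normc_distC.
  by rewrite ltr_distlC => *; apply/andP; split; lra.
- move=> [x y] /set_mem xyrho fmax; exists (x +i* y)%C => // -[x' y'] zrho.
  exact: (fmax (x', y') (mem_set zrho)).
Unshelve. all: by end_near. Qed.

(** If the bound fails inside, then [normc h + e |z|^2], for a small [e],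
    attains its maximum over the disc at an interior point [p].  On a small
    circle of radius [r] around [p] the mean of [normc h] is at least
    [normc (h p)] up to an arbitrarily small error, whereas the mean of
    [|z|^2] exceeds [|p|^2] by exactly [r ^+ 2]: a contradiction. *)
Theorem maximum_principle h (rho B : R) : 0 <= rho ->
  (forall p, normc p <= rho -> poly_approx h p) ->
  (forall z, normc z = rho -> normc (h z) <= B) ->
  forall z, normc z <= rho -> normc (h z) <= B.
Proof.
move=> rho0 happ hB z0 z0rho; rewrite leNgt; apply/negP => Bz0.
pose e := (normc (h z0) - B) / (rho ^+ 2 + 1).
have D0 : 0 < rho ^+ 2 + 1 by rewrite ltr_wpDl// sqr_ge0.
have e0 : 0 < e by rewrite divr_gt0// subr_gt0.
have eB : e * rho ^+ 2 < normc (h z0) - B.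
  by rewrite /e mulrAC ltr_pdivrMr// ltr_pM2l ?subr_gt0// ltrDl.
have [p prho pmax] := poly_approx_max e rho0 happ.
have {}prho : normc p < rho.
  rewrite lt_neqAle prho andbT; apply/eqP => prhoE.
  have := pmax _ z0rho; have := hB _ prhoE; rewrite prhoE.
  have : 0 <= e * normc z0 ^+ 2 by rewrite mulr_ge0 ?sqr_ge0// ltW.
  lra.
have [s s0 hs] := happ p (ltW prho).
pose r := Num.min s (rho - normc p).
have r0 : 0 < r by rewrite lt_min s0 subr_gt0.
pose t := e * r ^+ 2 / 4.
have t0 : 0 < t by rewrite divr_gt0// mulr_gt0// exprn_gt0.
have [q hq] := hs t t0.
pose n := (size q).+2.
have [w wn] := @prim_root_exists R[i] n isT.
pose c k : R[i] := p + r%:C%C * w ^+ k.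
have cp k : normc (c k - p) = r.
  rewrite /c addrC addKr normcM normc_exp (normc_prim_root wn) expr1n mulr1.
  by rewrite normc_real gtr0_norm.
have crho k : normc (c k) <= rho.
  have := normc_add (c k - p) p; rewrite subrK cp.
  have : r <= rho - normc p by rewrite ge_min lexx orbT.
  lra.
have hqc k : normc (h (c k) - q.[c k]) <= t by apply: hq; rewrite cp ge_min lexx.
have hqp : normc (h p - q.[p]) <= t by apply: hq; rewrite subrr normc0 ltW.
have hsum : (normc (h p) - t - t) *+ n <= \sum_(k < n) normc (h (c k)).
  have qsum : (normc (h p) - t) *+ n <= \sum_(k < n) normc q.[c k].
    apply: le_trans (normc_sum _ _ _).
    rewrite (@poly_mean _ n w)//; last by rewrite /n !leqW.
    rewrite -[q.[p] *+ n]mulr_natr normcM -[normc (h p) - t]mulr1 -mulrnAr.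
    have -> : normc n%:R = n%:R :> R.
      by rewrite -[n%:R](rmorph_nat (real_complex R)) normc_real normr_nat.
    apply: ler_wpM2r => //.
    by have := normc_add (h p - q.[p]) q.[p]; rewrite subrK; lra.
  rewrite mulrnDl -[n in - t *+ n]card_ord -sumr_const -lerBrDr -sumrN.
  apply: (le_trans qsum); rewrite -big_split/=; apply: ler_sum => k _.
  have := normc_add (q.[c k] - h (c k)) (h (c k)); have := hqc k.
  by rewrite subrK normc_distC; lra.
have ub : \sum_(k < n) (normc (h (c k)) + e * normc (c k) ^+ 2)
    <= (normc (h p) + e * normc p ^+ 2) *+ n.
  rewrite -[n in _ *+ n]card_ord -sumr_const; apply: ler_sum => k _.
  exact: pmax.
move: ub; rewrite big_split/= -mulr_sumr (@mean_sqr_circle _ n w)//.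
apply/negP; rewrite -ltNge; apply: lt_le_trans (lerD hsum (lexx _)).
rewrite mulrnAr -mulrnDl ltr_pMn2r//.
have -> : t = e * r ^+ 2 / 4 by [].
have : 0 < e * r ^+ 2 by rewrite mulr_gt0// exprn_gt0.
set u := e * r ^+ 2; rewrite mulrDr -/u; lra.
Qed.

End maximum_principle.
(** On the circle of radius [rho] the recurrence gives
    [|h_(n+1)| <= 2 sup |h_n| / rho], and the maximum principle carries this
    bound into the disc. *)
Lemma iterated_schwarz (R : realType) (h : nat -> R[i] -> R[i]) (rho B : R) :
  0 < rho ->
  (forall n p, normc p <= rho -> poly_approx (h n) p) ->
  (forall n z, normc z <= rho -> h n z = h n 0 + z * h n.+1 z) ->
  (forall z, normc z <= rho -> normc (h 0%N z) <= B) ->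
  forall n z, normc z <= rho -> normc (h n z) <= B * (2 / rho) ^+ n.
Proof.
move=> rho0 happ hrec hB; elim=> [|n ih].
  by move=> z zrho; rewrite expr0 mulr1 hB.
apply: maximum_principle (ltW rho0) (happ _) _ => z zrho.
have zle : normc z <= rho by rewrite zrho.
have zh : z * h n.+1 z = h n z - h n 0 by rewrite (hrec n z zle); ring.
have : normc (z * h n.+1 z) <= 2 * (B * (2 / rho) ^+ n).
  rewrite zh (le_trans (normc_add _ _))// normc_opp.
  have := ih z zle; have := ih 0; rewrite normc0 => /(_ (ltW rho0)); lra.
rewrite normcM zrho mulrC -ler_pdivlMr// => /le_trans; apply.
by rewrite exprSr -!mulrA [_ * (2 / rho)]mulrC !mulrA [2 * B]mulrC mulrAC.
Qed.

Section polynomial_approximation_limits.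
Variable R : realType.
Implicit Types (h g : R[i] -> R[i]) (p z : R[i]).

Lemma nondecreasing_bounded_cauchy (A : nat -> R) (K e : R) :
  {homo A : m n / (m <= n)%N >-> m <= n} -> (forall n, A n <= K) -> 0 < e ->
  exists M0, forall M, (M0 <= M)%N -> A M - A M0 <= e.
Proof.
move=> Ahomo AK e0.
have supA : has_sup (range A) by split; [exists (A 0%N), 0%N|exists K => _ [n _ <-]].
have [_ [M0 _ <-] AM0] := sup_adherent e0 supA.
exists M0 => M _; have : A M <= sup (range A) by apply: sup_upper_bound => //; exists M.
lra.
Qed.

(** A bounded majorant [A] of the increments makes the pointwise limit
    uniform. *)
Lemma poly_approx_limit h p (r K : R) (Q : nat -> {poly R[i]}) (A : nat -> R) :
  0 < r -> (forall n, A n <= K) ->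
  (forall m n z, (m <= n)%N -> normc (z - p) <= r ->
     normc ((Q n).[z - p] - (Q m).[z - p]) <= A n - A m) ->
  (forall z, normc (z - p) <= r ->
     normc ((Q n).[z - p] - h z) @[n --> \oo] --> (0 : R)) ->
  poly_approx h p.
Proof.
move=> r0 AK QA Qh; exists r => // e e0.
have e20 : 0 < e / 2 by rewrite divr_gt0.
have [m n mn|M0 AM0] := @nondecreasing_bounded_cauchy A K (e / 2) _ AK e20.
  have := QA _ _ p mn; rewrite subrr normc0 => /(_ (ltW r0)).
  by have := normc_ge0 ((Q n).[0] - (Q m).[0]); lra.
exists (Q M0 \Po ('X - p%:P)) => z zr.
rewrite horner_comp hornerXsubC.
have /cvgrPdist_lt/(_ _ e20)[M1 _ hM1] := Qh z zr.
pose M := maxn M0 M1.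
have {}hM1 := hM1 M (leq_maxr _ _).
rewrite /= sub0r normrN ger0_norm ?normc_ge0// in hM1.
have := QA _ _ z (leq_maxl M0 M1) zr; have := AM0 M (leq_maxl _ _); rewrite -/M.
have := normc_add (h z - (Q M).[z - p]) ((Q M).[z - p] - (Q M0).[z - p]).
rewrite addrA subrK [normc (h z - (Q M).[_])]normc_distC; lra.
Qed.

Lemma poly_approx_ext h g p (d : R) : 0 < d ->
  (forall z, normc (z - p) < d -> h z = g z) -> poly_approx g p -> poly_approx h p.
Proof.
move=> d0 hg [r r0 gr].
exists (Num.min r (d / 2)); first by rewrite lt_min r0 divr_gt0.
move=> e /gr[q gq]; exists q => z; rewrite le_min => /andP[zr zd].
by rewrite hg ?gq//; lra.
Qed.

End polynomial_approximation_limits.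

(** * Power series in several variables restricted to a complex line *)

Section multi_index.
Variable d : nat.

Definition mdegree (a : {ffun 'I_d -> nat}) := (\sum_i a i)%N.

Lemma leq_mdegree (a : {ffun 'I_d -> nat}) i : (a i <= mdegree a)%N.
Proof. by rewrite /mdegree (bigD1 i)//= leq_addr. Qed.

Lemma mmonomialZ (R : realType) (a : {ffun 'I_d -> nat}) (t : R[i]) (v : 'rV[R[i]]_d) :
  mmonomial a (t *: v) = t ^+ mdegree a * mmonomial a v.
Proof.
rewrite /mmonomial /mdegree -prodrXr -big_split/=.
by apply: eq_bigr => i _; rewrite mxE exprMn.
Qed.

(** Partial sums of power series run over the cubes [{0, ..., m - 1}^d]; this
    family of lemmas compares the sums over two cubes. *)
Lemma sum_cube_widen (V : nmodType) (P : pred {ffun 'I_d -> nat})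
    (F : {ffun 'I_d -> nat} -> V) (m n : nat) : (m <= n)%N ->
  \sum_(a : {ffun 'I_d -> 'I_m} | P (nat_index a)) F (nat_index a) =
  \sum_(a : {ffun 'I_d -> 'I_n} | P (nat_index a) && [forall i, (a i < m)%N])
     F (nat_index a).
Proof.
move=> mn; pose h (a : {ffun 'I_d -> 'I_m}) := [ffun i => widen_ord mn (a i)].
have hE a : nat_index (h a) = nat_index a by apply/ffunP => i; rewrite !ffunE.
have h_inj : injective h.
  move=> a b /ffunP ab; apply/ffunP => i; apply: val_inj.
  by have := congr1 val (ab i); rewrite !ffunE.
under eq_bigl do rewrite -hE.
under eq_bigr do rewrite -hE.
rewrite -(big_imset (fun b => F (nat_index b))
  (in2W h_inj : {in [pred a | P (nat_index (h a))] &, injective h}))/=.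
apply: eq_bigl => b; apply/imsetP/andP => [[a Pa ->]|[Pb /forallP bm]].
  by split=> //; apply/forallP => i; rewrite ffunE/=.
exists [ffun i => Ordinal (bm i)]; last first.
  by apply/ffunP => i; apply: val_inj; rewrite !ffunE.
rewrite inE (_ : nat_index _ = nat_index b)//.
by apply/ffunP => i; rewrite !ffunE.
Qed.

Lemma sum_cube_eq (V : nmodType) (P : pred {ffun 'I_d -> nat})
    (F : {ffun 'I_d -> nat} -> V) (m n : nat) : (m <= n)%N ->
  (forall a, P a -> forall i, (a i < m)%N) ->
  \sum_(a : {ffun 'I_d -> 'I_n} | P (nat_index a)) F (nat_index a) =
  \sum_(a : {ffun 'I_d -> 'I_m} | P (nat_index a)) F (nat_index a).
Proof.
move=> mn Pm; rewrite (sum_cube_widen _ _ mn); apply: eq_bigl => a.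
case Pa : (P _) => //=; apply/esym/forallP => i.
by have := Pm _ Pa i; rewrite ffunE.
Qed.

Lemma sum_cube_diff (V : zmodType) (P : pred {ffun 'I_d -> nat})
    (F : {ffun 'I_d -> nat} -> V) (m n : nat) : (m <= n)%N ->
  \sum_(a : {ffun 'I_d -> 'I_n} | P (nat_index a)) F (nat_index a) -
  \sum_(a : {ffun 'I_d -> 'I_m} | P (nat_index a)) F (nat_index a) =
  \sum_(a : {ffun 'I_d -> 'I_n} | P (nat_index a) && ~~ [forall i, (a i < m)%N])
     F (nat_index a).
Proof.
move=> mn; rewrite (sum_cube_widen _ _ mn).
rewrite (bigID (fun a : {ffun 'I_d -> 'I_n} => [forall i, (a i < m)%N]))/=.
by rewrite addrAC subrr add0r.
Qed.

End multi_index.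
Section power_series_on_a_line.
Variables (R : realType) (d : nat) (coef : {ffun 'I_d -> nat} -> R[i]).
Variable v : 'rV[R[i]]_d.
Implicit Types (t : R[i]) (n m N : nat).

Let weight (a : {ffun 'I_d -> nat}) := coef a * mmonomial a v.

(** The [m]-th partial sum of the series at [p + t *: v], stripped of the terms
    of degree less than [N] and divided by [t ^+ N]. *)
Definition line_poly N m : {poly R[i]} :=
  \sum_(a : {ffun 'I_d -> 'I_m} | (N <= mdegree (nat_index a))%N)
     weight (nat_index a) *: 'X^(mdegree (nat_index a) - N).

Definition line_taylor N : {poly R[i]} :=
  \sum_(a : {ffun 'I_d -> 'I_N} | (mdegree (nat_index a) < N)%N)
     weight (nat_index a) *: 'X^(mdegree (nat_index a)).

Definition line_coef N : R[i] :=
  \sum_(a : {ffun 'I_d -> 'I_N.+1} | mdegree (nat_index a) == N)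
     weight (nat_index a).

Lemma line_taylorE N t : (line_taylor N).[t] =
  \sum_(a : {ffun 'I_d -> 'I_N} | (mdegree (nat_index a) < N)%N)
     coef (nat_index a) * mmonomial (nat_index a) (t *: v).
Proof.
rewrite horner_sum; apply: eq_bigr => a _.
by rewrite hornerZ hornerXn mmonomialZ /weight mulrAC -mulrA.
Qed.

Lemma line_poly0E n t : (line_poly 0 n).[t] =
  \sum_(a : {ffun 'I_d -> 'I_n})
     coef (nat_index a) * mmonomial (nat_index a) (t *: v).
Proof.
rewrite horner_sum; apply: eq_bigr => a _.
by rewrite subn0 hornerZ hornerXn mmonomialZ /weight mulrAC -mulrA.
Qed.

Lemma line_taylorS N t :
  (line_taylor N.+1).[t] = (line_taylor N).[t] + line_coef N * t ^+ N.
Proof.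
pose F (P : pred nat) m := \sum_(a : {ffun 'I_d -> 'I_m} | P (mdegree (nat_index a)))
   weight (nat_index a) * t ^+ mdegree (nat_index a).
have TE m : (line_taylor m).[t] = F (fun k => (k < m)%N) m.
  by rewrite horner_sum; apply: eq_bigr => a _; rewrite hornerZ hornerXn.
rewrite !TE; transitivity (F (fun k => (k < N)%N) N.+1 + F (fun k => k == N) N.+1).
  rewrite /F (bigID (fun a : {ffun 'I_d -> 'I_N.+1} =>
    (mdegree (nat_index a) < N)%N))/=.
  congr (_ + _); apply: eq_bigl => a.
    by rewrite andbC ltnS; case: ltnP => //= /ltnW.
  by rewrite -leqNgt ltnS eqn_leq.
congr (_ + _); last first.
  by rewrite mulr_suml; apply: eq_bigr => a /eqP ->.
apply: (@sum_cube_eq _ _ (fun a => (mdegree a < N)%N)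
  (fun a => weight a * t ^+ mdegree a)); first exact: leqnSn.
by move=> a aN i; apply: leq_ltn_trans (leq_mdegree _ _) aN.
Qed.

(** Valid only for [N <= n]: the cube of side [n] must contain all the
    multi-indices of degree less than [N]. *)
Lemma line_poly_shift N n t : (N <= n)%N ->
  t ^+ N * (line_poly N n).[t] = (line_poly 0 n).[t] - (line_taylor N).[t].
Proof.
move=> Nn; apply/eqP; rewrite -subr_eq0 opprB addrA subr_eq0 addrC; apply/eqP.
pose F (P : pred nat) m := \sum_(a : {ffun 'I_d -> 'I_m} | P (mdegree (nat_index a)))
   weight (nat_index a) * t ^+ mdegree (nat_index a).
have -> : (line_taylor N).[t] = F (fun k => (k < N)%N) n.
  transitivity (F (fun k => (k < N)%N) N).
    by rewrite horner_sum; apply: eq_bigr => a _; rewrite hornerZ hornerXn.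
  apply/esym/(@sum_cube_eq _ _ (fun a => (mdegree a < N)%N)
    (fun a => weight a * t ^+ mdegree a)) => //.
  by move=> a aN i; apply: leq_ltn_trans (leq_mdegree _ _) aN.
rewrite [in RHS]horner_sum (bigID (fun a : {ffun 'I_d -> 'I_n} =>
  (mdegree (nat_index a) < N)%N))/=.
congr (_ + _); first by apply: eq_bigr => a _; rewrite subn0 hornerZ hornerXn.
rewrite horner_sum mulr_sumr; apply: eq_big => [a|a aN]; first by rewrite -leqNgt.
by rewrite !hornerZ !hornerXn subn0 mulrCA -exprD subnKC.
Qed.

Lemma line_poly_at0 N n : (N < n)%N -> (line_poly N n).[0] = line_coef N.
Proof.
move=> Nn; rewrite horner_sum.
rewrite (bigID (fun a : {ffun 'I_d -> 'I_n} => mdegree (nat_index a) == N))/=.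
rewrite [X in _ + X]big1 ?addr0 => [|a /andP[Na aN]]; last first.
  by rewrite hornerZ hornerXn expr0n subn_eq0 leqNgt ltn_neqAle eq_sym aN Na mulr0.
have Nsmall a : mdegree a == N -> forall i : 'I_d, (a i < N.+1)%N.
  by move=> /eqP <- i; rewrite ltnS leq_mdegree.
apply: etrans (sum_cube_eq weight Nn Nsmall).
apply: eq_big => [a|a /andP[_ /eqP ->]].
  by case: eqP => [->|_]; rewrite ?leqnn ?andbF.
by rewrite subnn hornerZ hornerXn expr0 mulr1.
Qed.

(** Partial sums of the series of moduli on the circle of radius [rho]: they
    majorize the increments of [line_poly]. *)
Definition line_abs (rho : R) n : R :=
  \sum_(a : {ffun 'I_d -> 'I_n})
     normc (weight (nat_index a)) * rho ^+ mdegree (nat_index a).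

Lemma line_poly_cauchy N m n (rho : R) t : (m <= n)%N -> 0 < rho ->
  normc t <= rho ->
  normc ((line_poly N n).[t] - (line_poly N m).[t]) <=
    rho ^- N * line_abs rho n - rho ^- N * line_abs rho m.
Proof.
move=> mn rho0 trho.
have LE k : (line_poly N k).[t] =
   \sum_(a : {ffun 'I_d -> 'I_k} | (N <= mdegree (nat_index a))%N)
     weight (nat_index a) * t ^+ (mdegree (nat_index a) - N).
  by rewrite horner_sum; apply: eq_bigr => a _; rewrite hornerZ hornerXn.
rewrite !LE (sum_cube_diff (fun a => (N <= mdegree a)%N)
  (fun a => weight a * t ^+ (mdegree a - N)) mn).
rewrite -mulrBr /line_abs (sum_cube_diff xpredT
  (fun a => normc (weight a) * rho ^+ mdegree a) mn)/=.
rewrite (le_trans (normc_sum _ _ _))// mulr_sumr.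
rewrite [leRHS](bigID (fun a : {ffun 'I_d -> 'I_n} =>
  (N <= mdegree (nat_index a))%N))/=.
rewrite ler_wpDr//.
  apply: sumr_ge0 => a _; rewrite mulr_ge0 ?invr_ge0 ?exprn_ge0 ?(ltW rho0)//.
  by rewrite mulr_ge0 ?normc_ge0// exprn_ge0// ltW.
rewrite [leRHS](eq_bigl (fun a : {ffun 'I_d -> 'I_n} => (N <= mdegree (nat_index a))%N
  && ~~ [forall i, (a i < m)%N])); last by move=> a; rewrite andbC.
apply: ler_sum => a /andP[Na _].
rewrite normcM mulrCA ler_wpM2l ?normc_ge0// normc_exp -[in leRHS](subnKC Na) exprD.
rewrite mulKf; last by rewrite expf_neq0// gt_eqF.
by rewrite lerXn2r ?nnegrE ?normc_ge0// ltW.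
Qed.

End power_series_on_a_line.
(** * The Taylor remainder along a complex line *)

Section taylor_on_a_line.
Variables (R : realType) (d : nat) (f : 'rV[R[i]]_d -> R[i]).
Implicit Types (p v : 'rV[R[i]]_d) (t : R[i]).

(** The convergence clause of [analytic_at], with radius and coefficients
    named: the remainder estimate speaks of the series at one point. *)
Definition power_series_at p (r : R) (coef : {ffun 'I_d -> nat} -> R[i]) :=
  forall z : 'rV[R[i]]_d, (forall i, normc (z 0 i - p 0 i) < r) ->
    (exists M : R, forall N, \sum_(alpha : {ffun 'I_d -> 'I_N})
       normc (coef (nat_index alpha) * mmonomial (nat_index alpha) (z - p)) <= M) /\
    (fun N => normc (\sum_(alpha : {ffun 'I_d -> 'I_N})
       coef (nat_index alpha) * mmonomial (nat_index alpha) (z - p) - f z))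
       @ \oo --> (0 : R).

Lemma power_series_on_line p r coef v : 0 < r -> power_series_at p r coef ->
  exists rho K : R, [/\ 0 < rho, forall n, line_abs coef v rho n <= K
    & forall t, normc t <= rho ->
      normc ((line_poly coef v 0 n).[t] - f (p + t *: v)) @[n --> \oo] --> (0 : R)].
Proof.
move=> r0 fp; pose V := \sum_i normc (v 0 i).
have V0 : 0 <= V by apply: sumr_ge0 => i _; exact: normc_ge0.
have V1 : 0 < 1 + V by rewrite ltr_pwDl.
pose rho := r / (1 + V).
have rho0 : 0 < rho by rewrite divr_gt0.
have small t : normc t <= rho -> forall i, normc ((p + t *: v) 0 i - p 0 i) < r.
  move=> trho i; rewrite !mxE addrC addKr normcM.
  rewrite (@le_lt_trans _ _ (rho * V))//.
    rewrite ler_pM ?normc_ge0// /V (bigD1 i)//= lerDl.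
    by apply: sumr_ge0 => j _; exact: normc_ge0.
  by rewrite /rho mulrAC ltr_pdivrMr// ltr_pM2l// ltrDr.
have rhoE : normc (rho%:C%C : R[i]) = rho by rewrite normc_real gtr0_norm.
have [|[K hK] _] := fp (p + rho%:C%C *: v); first by apply: small; rewrite rhoE.
exists rho, K; split=> // [n|t trho].
  rewrite (le_trans _ (hK n))//; apply: ler_sum => a _.
  by rewrite [p + _]addrC addrK mmonomialZ !normcM normc_exp rhoE mulrAC mulrA.
have [_] := fp _ (small t trho).
rewrite [p + _]addrC addrK => h.
by under eq_fun do rewrite line_poly0E addrC [p + _]addrC.
Qed.

Lemma analytic_poly_approx p v t : analytic_at f (p + t *: v) ->
  poly_approx (fun s => f (p + s *: v)) t.
Proof.
move=> [r [coef [r0 fp]]].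
have [rho [K [rho0 hK hcvg]]] := power_series_on_line v r0 fp.
apply: (@poly_approx_limit _ _ _ rho (rho ^- 0 * K) (line_poly coef v 0)
  (fun n => rho ^- 0 * line_abs coef v rho n)) => //.
- by move=> n; rewrite ler_wpM2l// invr_ge0 exprn_ge0// ltW.
- by move=> m n z mn zrho; exact: line_poly_cauchy.
- move=> z /hcvg; rewrite -addrA -scalerDl [t + _]addrC subrK; exact.
Qed.

(** The series at [p] only describes [f] near [p], while the estimate reaches
    [p + v], that is [t = 1] in a disc of radius [rho].  The quotients
    [h n t = (g t - T n t) / t ^ n], [g t = f (p + t *: v)], are locally uniform
    limits of polynomials everywhere in the disc: at [t != 0] because [g] and
    [1 / t] are, at [t = 0] because the series at [p] can be divided by
    [t ^ n].  So [iterated_schwarz] applies to them. *)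
Theorem taylor_remainder_on_line p v (r rho B : R) coef :
  0 < r -> 1 <= rho -> power_series_at p r coef ->
  (forall t, normc t <= rho -> analytic_at f (p + t *: v)) ->
  (forall t, normc t <= rho -> normc (f (p + t *: v)) <= B) ->
  forall N, normc (f (p + v) -
     \sum_(a : {ffun 'I_d -> 'I_N} | (mdegree (nat_index a) < N)%N)
     coef (nat_index a) * mmonomial (nat_index a) v) <= B * (2 / rho) ^+ N.
Proof.
move=> r0 rho1 fp fan fB N.
have rho0 : 0 < rho by exact: lt_le_trans rho1.
pose g t := f (p + t *: v).
pose T n := line_taylor coef v n.
pose h n t := if t == 0 then line_coef coef v n else (g t - (T n).[t]) / t ^+ n.
have gapprox t : normc t <= rho -> poly_approx g t.
  by move=> trho; apply: analytic_poly_approx; exact: fan.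
have happ n t : normc t <= rho -> poly_approx (h n) t.
  move=> trho; have [->{t trho}|t0] := eqVneq t 0.
    have [rho' [K [rho'0 hK hcvg]]] := power_series_on_line v r0 fp.
    apply: (@poly_approx_limit _ _ _ rho' (rho' ^- n * K)
      (fun m => line_poly coef v n (m + n).+1)
      (fun m => rho' ^- n * line_abs coef v rho' (m + n).+1)) => //.
    - by move=> m; rewrite ler_wpM2l// invr_ge0 exprn_ge0// ltW.
    - move=> m m' z mm' zrho; apply: line_poly_cauchy => //.
      by rewrite ltnS leq_add2r.
    - move=> z; rewrite subr0 => zrho; rewrite /h; have [->|z0] := eqVneq z 0.
        under eq_fun do rewrite line_poly_at0 ?ltnS ?leq_addl// subrr normc0.
        exact: cvg_cst.
      have zn0 : z ^+ n != 0 by rewrite expf_neq0.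
      have E m :
          normc ((line_poly coef v n (m + n).+1).[z] - (g z - (T n).[z]) / z ^+ n)
         = (normc z ^+ n)^-1 * normc ((line_poly coef v 0 (m + n).+1).[z] - g z).
        rewrite -normc_exp -normcV -normcM; congr normc.
        have nm : (n <= (m + n).+1)%N by rewrite leqW// leq_addl.
        have -> : (line_poly coef v 0 (m + n).+1).[z]
            = z ^+ n * (line_poly coef v n (m + n).+1).[z] + (T n).[z].
          by rewrite line_poly_shift// subrK.
        by field.
      under eq_fun do rewrite E.
      have -> : 0 = (normc z ^+ n)^-1 * 0 by rewrite mulr0.
      apply: cvgMr.
      under eq_fun do rewrite -addnS.
      by have := hcvg _ zrho; rewrite -(cvg_shiftn n.+1).
  apply: (@poly_approx_ext _ _
    (fun z => (g z + (- T n).[z]) * (z ^-1) ^+ n) _ (normc t)).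
  - exact: normc_gt0.
  - move=> z zt; rewrite /h ifN ?hornerN ?exprVn//.
    by apply: contraTneq zt => ->; rewrite sub0r normc_opp ltxx.
  - apply: poly_approx_mul.
      by apply: poly_approx_add; [exact: gapprox|exact: poly_approx_poly].
    elim: n => [|n ih].
      have := poly_approx_poly 1 t; apply: poly_approx_ext ltr01 _ => z _.
      by rewrite expr0 hornerC.
    have := poly_approx_mul (poly_approx_inv t0) ih.
    by apply: poly_approx_ext ltr01 _ => z _; rewrite exprS.
have hrec n t : normc t <= rho -> h n t = h n 0 + t * h n.+1 t.
  move=> _; rewrite /h eqxx; have [->|t0] := eqVneq t 0; first by rewrite mul0r addr0.
  rewrite /T line_taylorS exprS.
  have tn0 : t ^+ n != 0 by rewrite expf_neq0.
  by field; rewrite tn0 t0.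
have coef0 : line_coef coef v 0 = g 0.
  have [rho' [K [rho'0 _ hcvg]]] := power_series_on_line v r0 fp.
  apply/eqP; rewrite -subr_eq0; apply/eqP/eq0_normc.
  have := hcvg 0; rewrite normc0 => /(_ (ltW rho'0)).
  rewrite -(cvg_shiftn 1) /=; under eq_fun do rewrite line_poly_at0 ?addn1//.
  by move=> c0; apply: (cvg_unique _ _ c0) => //; exact: cvg_cst.
have hB t : normc t <= rho -> normc (h 0%N t) <= B.
  move=> trho; have T0 : (T 0%N).[t] = 0 by rewrite line_taylorE big_pred0.
  rewrite /h; have [_|t0] := eqVneq t 0; first by rewrite coef0 fB// normc0 ltW.
  by rewrite T0 subr0 expr0 divr1 fB.
have := iterated_schwarz rho0 happ hrec hB N (z := 1); rewrite normc1 => /(_ rho1).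
by rewrite /h oner_eq0 expr1n divr1 /g /T line_taylorE scale1r.
Qed.

End taylor_on_a_line.
(** * A polydisc around each point of the box inside the polyellipse *)

Section bernstein_ellipse_margin.
Variable R : realType.

(** The distance from [-1, 1] to the complement of the Bernstein ellipse is the
    value at [s = r] of the increasing function [(s - 1)^2 / (2 s)]. *)
Definition ellipse_margin (r : R) : R := (r - 1) ^+ 2 / (2 * r).

Lemma ellipse_margin_gt0 r : 1 < r -> 0 < ellipse_margin r.
Proof. by move=> r1; rewrite divr_gt0 ?exprn_gt0 ?subr_gt0 ?mulr_gt0//; lra. Qed.

(** The two solutions of [z ^+ 2 - 2 * w * z + 1 = 0] are inverse to each
    other, so one of them has modulus at least [1]. *)
Lemma joukowski_preimage (w : R[i]) :
  exists2 z : R[i], 1 <= normc z & (z + z^-1) / 2 = w.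
Proof.
pose u := w + sqrtC (w ^+ 2 - 1).
have uu : u * (2 * w - u) = 1.
  have -> : u * (2 * w - u) = w ^+ 2 - sqrtC (w ^+ 2 - 1) ^+ 2 by rewrite /u; ring.
  by rewrite sqrtCK; ring.
have u0 : u != 0.
  by apply/eqP => u0; move: uu; rewrite u0 mul0r => /esym/eqP; rewrite oner_eq0.
have uV : u^-1 = 2 * w - u by apply: (mulfI u0); rewrite mulfV.
have uw : (u + u^-1) / 2 = w by rewrite uV; field.
have [u1|u1] := leP 1 (normc u); first by exists u.
exists u^-1; last by rewrite invrK addrC.
have nu0 := normc_gt0 u0.
by rewrite normcV invf_ge1// ltW.
Qed.

(** Write [w0] as the real part of a unit number [e], with conjugate [e'].  If
    [w] is the image of [z], then [2 z (w - w0) = (z - e) (z - e')], hence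
    [(|z| - 1)^2 <= 2 |z| |w - w0|], and [|z| >= r] would contradict the
    hypothesis on [w - w0]. *)
Lemma bernstein_ellipse_near (r w0 : R) (w : R[i]) : 1 < r -> `|w0| <= 1 ->
  normc (w - w0%:C%C) < ellipse_margin r -> bernstein_ellipse r w.
Proof.
move=> r1 w01 ww0; have [z z1 zw] := joukowski_preimage w.
exists z => //=; rewrite z1/= ltNge; apply/negP => rz.
have w0sq : 0 <= 1 - w0 ^+ 2.
  by rewrite subr_ge0 -[w0 ^+ 2]real_normK ?num_real// expr_le1.
pose s := Num.sqrt (1 - w0 ^+ 2).
have ss : s ^+ 2 = 1 - w0 ^+ 2 by rewrite sqr_sqrtr.
have unit_s (e : R) : e ^+ 2 = s ^+ 2 -> normc (w0 +i* e)%C = 1.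
  by move=> es; rewrite /= es ss addrC subrK sqrtr1.
have z0 : z != 0 by apply: contraTneq z1 => ->; rewrite normc0 ler10.
have factor : (z - (w0 +i* s)%C) * (z - (w0 +i* (- s))%C) = 2 * z * (w - w0%:C%C).
  have -> : 2 * z * (w - w0%:C%C) = z ^+ 2 + 1 - 2 * z * w0%:C%C by rewrite -zw; field.
  case: (z) => x y; apply/eqP; rewrite eq_complex /=.
  by apply/andP; split; apply/eqP; simpc => /=; rewrite -?expr2; nra.
have lower (e : R) : e ^+ 2 = s ^+ 2 -> normc z - 1 <= normc (z - (w0 +i* e)%C).
  move=> /unit_s e1; have := normc_add (z - (w0 +i* e)%C) (w0 +i* e)%C.
  by rewrite subrK e1; lra.
have : (normc z - 1) ^+ 2 <= 2 * normc z * normc (w - w0%:C%C).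
  have -> : 2 * normc z * normc (w - w0%:C%C) = normc (2 * z * (w - w0%:C%C)).
    by rewrite !normcM -[2 in RHS](rmorph_nat (real_complex R)) normc_real normr_nat.
  by rewrite -factor normcM expr2 ler_pM ?subr_ge0 ?lower// sqrrN.
apply/negP; rewrite -ltNge.
have zp : 0 < 2 * normc z by lra.
rewrite -ltr_pdivlMl// mulrC (lt_le_trans ww0)// /ellipse_margin.
rewrite ler_pdivlMr// mulrAC ler_pdivrMr; last by lra.
set y := normc z in z1 rz *; rewrite -subr_ge0.
have -> : (y - 1) ^+ 2 * (2 * r) - (r - 1) ^+ 2 * (2 * y)
  = 2 * (y - r) * (r * y - 1) by ring.
rewrite mulr_ge0 ?subr_ge0//; last by nra.
by rewrite mulr_ge0 ?subr_ge0.
Qed.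

Lemma polyellipse_near (d : nat) (a b p : 'rV[R]_d) (r : R) (xi : 'rV[R[i]]_d) :
  1 < r -> (forall i, a 0 i < b 0 i) -> box a b p ->
  (forall i, normc (xi 0 i - (p 0 i)%:C%C)
     < ellipse_margin r * ((b 0 i - a 0 i) / 2)) ->
  polyellipse a b r xi.
Proof.
move=> r1 ab abp xip i.
pose m := (a 0 i + b 0 i) / 2; pose h := (b 0 i - a 0 i) / 2.
have h0 : 0 < h by rewrite divr_gt0// subr_gt0.
have hC0 : h%:C%C != 0 :> R[i] by rewrite (inj_eq (@complexI _) h 0) gt_eqF.
exists ((xi 0 i - m%:C%C) / h%:C%C); last by rewrite mulrCA mulfV// mulr1 addrC subrK.
apply: (@bernstein_ellipse_near _ ((p 0 i - m) / h)) => //.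
  have /andP[ap pb] := abp i.
  rewrite normf_div (gtr0_norm h0) ler_pdivrMr// mul1r ler_norml /h /m.
  by apply/andP; split; lra.
have -> : ((p 0 i - m) / h)%:C%C = ((p 0 i)%:C%C - m%:C%C) / h%:C%C :> R[i].
  by rewrite rmorphM fmorphV rmorphB.
rewrite -mulrBl opprB addrA subrK normcM normcV normc_real.
by rewrite gtr0_norm// ltr_pdivrMr// /h xip.
Qed.

End bernstein_ellipse_margin.

(** * Piecewise polynomial approximation on the box *)

Section cells.
Variables (R : realType) (d : nat) (a b : 'rV[R]_d).
Hypothesis ab : forall i, a 0 i < b 0 i.
Variable M : nat.
Hypothesis M_gt0 : (0 < M)%N.

Definition cell_width i : R := (b 0 i - a 0 i) / M%:R.

(** Cells are half-open and indexed by [{0, ..., M}^d], so that they are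
    disjoint and those of index [M] catch the upper faces of the box; every
    corner still lies in the box. *)
Definition cell_corner (beta : {ffun 'I_d -> 'I_M.+1}) : 'rV[R]_d :=
  \row_i (a 0 i + (beta i)%:R * cell_width i).

Definition cell_side beta i : set R :=
  `[cell_corner beta 0 i, cell_corner beta 0 i + cell_width i[.

(** The indicator function of the cell is distributed over the coordinates:
    measurability and bounds are then proved factor by factor. *)
Definition cell_monomial N beta (alpha : {ffun 'I_d -> 'I_N}) (x : 'rV[R]_d) : R :=
  \prod_i (\1_(cell_side beta i) (x 0 i) * (x 0 i - cell_corner beta 0 i) ^+ alpha i).

Lemma cell_width_gt0 i : 0 < cell_width i.
Proof. by rewrite divr_gt0 ?subr_gt0// ltr0n. Qed.

Lemma cell_sideE beta i (y : R) :
  cell_side beta i y <-> Num.truncn ((y - a 0 i) / cell_width i) = beta i :> nat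
    /\ a 0 i <= y.
Proof.
have w0 := cell_width_gt0 i.
rewrite /cell_side /= in_itv/= mxE.
have -> : (a 0 i + (beta i)%:R * cell_width i <= y
      < a 0 i + (beta i)%:R * cell_width i + cell_width i) =
   ((beta i)%:R <= (y - a 0 i) / cell_width i < (beta i).+1%:R).
  rewrite ler_pdivlMr// ltr_pdivrMr// -[(beta i).+1%:R]natr1 mulrDl mul1r.
  by rewrite lerBrDl ltrBlDl addrA.
split=> [h|[<- ay]].
  split; first exact: truncn_def.
  have /andP[h1 _] := h; move: (le_trans (ler0n R (beta i)) h1).
  by rewrite pmulr_lge0 ?invr_gt0// subr_ge0.
by rewrite truncn_itv// divr_ge0 ?subr_ge0// ltW.
Qed.

Lemma cell_corner_box beta : box a b (cell_corner beta).
Proof.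
move=> i; rewrite mxE lerDl mulr_ge0 ?ler0n ?(ltW (cell_width_gt0 i))//=.
rewrite -lerBrDl /cell_width mulrC -mulrA ler_piMr ?subr_ge0 ?(ltW (ab i))//.
by rewrite mulrC ler_pdivrMr ?ltr0n// mul1r ler_nat -ltnS.
Qed.

Lemma box_in_cell x : box a b x ->
  exists beta, forall beta', (beta' = beta) <-> (forall i, cell_side beta' i (x 0 i)).
Proof.
move=> abx.
have small i : (Num.truncn ((x 0%R i - a 0%R i) / cell_width i)%R < M.+1)%N.
  rewrite truncn_lt_nat; last first.
    by have /andP[? _] := abx i; rewrite divr_ge0 ?subr_ge0// ltW// cell_width_gt0.
  rewrite ltr_pdivrMr ?cell_width_gt0// -natr1 mulrDl mul1r.
  have -> : M%:R * cell_width i = b 0 i - a 0 i by rewrite mulrC divfK// pnatr_eq0 -lt0n.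
  by have /andP[_ ?] := abx i; have := cell_width_gt0 i; lra.
exists [ffun i => Ordinal (small i)] => beta'; split=> [-> i|h].
  by apply/cell_sideE; rewrite ffunE; split=> //; have /andP[] := abx i.
by apply/ffunP => i; rewrite ffunE; apply: val_inj; have /cell_sideE[/= -> _] := h i.
Qed.

Lemma cell_monomial_in N beta alpha (x : 'rV[R]_d) :
  (forall i, cell_side beta i (x 0 i)) ->
  @cell_monomial N beta alpha x = \prod_i (x 0 i - cell_corner beta 0 i) ^+ alpha i.
Proof. by move=> xb; apply: eq_bigr => i _; rewrite indicE mem_set// mul1r. Qed.

Lemma cell_monomial_out N beta alpha (x : 'rV[R]_d) :
  ~ (forall i, cell_side beta i (x 0 i)) ->
  @cell_monomial N beta alpha x = 0.
Proof.
move=> /existsNP[i xi]; rewrite /cell_monomial (bigD1 i)//= indicE memNset//.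
by rewrite !mul0r.
Qed.

Lemma measurable_coord i :
  measurable_fun [set: borel 'rV[R]_d] (fun x : 'rV[R]_d => x 0 i).
Proof.
apply: (measurability _ (RGenOInfty.measurableE R)) => _ [_ [c ->] <-].
rewrite setTI; apply: sub_sigma_algebra.
have /continuousP := @coord_continuous R 1 d 0 i; apply.
by rewrite set_itv_o_infty; exact: open_gt.
Qed.

Lemma measurable_cell_monomial N beta alpha :
  measurable_fun [set: borel 'rV[R]_d] (@cell_monomial N beta alpha).
Proof.
apply: measurable_prod => i _; apply: measurable_funM.
  apply: measurableT_comp (measurable_coord i); apply: measurable_indic.
  exact: measurable_itv.
apply: measurable_funX; apply: measurable_funB => //.
exact: measurable_coord.
Qed.

End cells.
(** For [x] in the cell of corner [p], the line through [p] and [x] stays in the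
    polyellipse for complex parameters of modulus at most [rho], because the
    cell is that much smaller than the margin.  The coefficients are the real
    parts of the Taylor coefficients of the extension at the corners; taking
    real parts does not increase the error since [g] is real. *)
Lemma cell_approximation (R : realType) (d : nat) (a b : 'rV[R]_d) (r rho C : R)
    (M N : nat) (Omega : set 'rV[R]_d) (g : 'rV[R]_d -> R) :
  (forall i, a 0 i < b 0 i) -> 1 < r -> 1 <= rho ->
  2 * rho < ellipse_margin r * M%:R ->
  Omega `<=` box a b ->
  bounded_analytic_extension Omega (polyellipse a b r) C g ->
  exists s : {ffun 'I_d -> 'I_M.+1} -> {ffun 'I_d -> 'I_N} -> R,
  forall x, Omega x ->
    `|g x - \sum_beta \sum_alpha s beta alpha * cell_monomial a b beta alpha x|
      <= C * (2 / rho) ^+ N.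
Proof.
move=> ab r1 rho1 rhoM Obox [f [fan fg fC]].
have M0 : (0 < M)%N.
  by rewrite lt0n; apply: contraTneq rhoM => ->; rewrite mulr0 -leNgt; lra.
pose p beta : 'rV[R[i]]_d := map_mx (real_complex R) (cell_corner a b (M := M) beta).
have corner_in beta := cell_corner_box ab M0 beta.
have margin0 := ellipse_margin_gt0 r1.
have near beta (v : 'rV[R[i]]_d) (t : R[i]) :
    (forall i, normc (v 0 i) <= cell_width a b M i) -> normc t <= rho ->
    polyellipse a b r (p beta + t *: v).
  move=> vw trho; apply: polyellipse_near (corner_in beta) _ => // i.
  rewrite !mxE addrAC subrr add0r normcM.
  apply: (@le_lt_trans _ _ (rho * cell_width a b M i)).
    by rewrite ler_pM ?normc_ge0.
  rewrite /cell_width mulrA ltr_pdivrMr ?ltr0n//.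
  have := ab i; rewrite -subr_gt0 => ab0.
  have -> : ellipse_margin r * ((b 0 i - a 0 i) / 2) * M%:R
    = (ellipse_margin r * M%:R) / 2 * (b 0 i - a 0 i) by ring.
  by rewrite ltr_pM2r// ltr_pdivlMr// mulrC.
have /choice[rc rcP] : forall beta, exists rc : R * ({ffun 'I_d -> nat} -> R[i]),
    0 < rc.1 /\ power_series_at f (p beta) rc.1 rc.2.
  move=> beta.
  have [|rr [coef [rr0 fp]]] := fan (p beta); last by exists (rr, coef).
  have := near beta 0 0; rewrite scaler0 addr0; apply; last by rewrite normc0; lra.
  by move=> i; rewrite mxE normc0 ltW// cell_width_gt0.
exists (fun beta alpha => if (mdegree (nat_index alpha) < N)%N then
  complex.Re ((rc beta).2 (nat_index alpha)) else 0) => x Ox.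
have [beta betaP] := box_in_cell ab M0 (Obox _ Ox).
have xbeta : forall i, cell_side a b beta i (x 0 i) by apply/betaP.
rewrite (bigD1 beta)//= [X in _ - (_ + X)]big1 ?addr0; last first.
  move=> beta' /eqP b'b; apply: big1 => alpha _.
  by rewrite cell_monomial_out ?mulr0// => /betaP.
pose v : 'rV[R[i]]_d := map_mx (real_complex R) (x - cell_corner a b beta).
have vw i : normc (v 0 i) <= cell_width a b M i.
  rewrite mxE normc_real !mxE; have := xbeta i; rewrite /cell_side /= in_itv/= mxE.
  move=> /andP[h1 h2]; rewrite ger0_norm ?subr_ge0//; lra.
have [rr0 fp] := rcP beta.
have := taylor_remainder_on_line (v := v) (B := C) rr0 rho1 fp
  (fun t trho => fan _ (near beta v t vw trho))
  (fun t trho => fC _ (near beta v t vw trho)) N.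
have -> : p beta + v = map_mx (real_complex R) x by rewrite /p /v -map_mxD addrC subrK.
rewrite (fg _ Ox); apply: le_trans.
apply: le_trans (Re_le_normc _).
rewrite raddfB/= [X in _ <= `|_ - X|](raddf_sum (@complex.Re R)).
rewrite [X in _ <= `|_ - X|]big_mkcond/= le_eqVlt; apply/orP; left; apply/eqP.
congr (`| g x - _ |); apply: eq_bigr => alpha _.
rewrite cell_monomial_in//; case: ifPn => _; last by rewrite mul0r.
have -> : mmonomial (nat_index alpha) v =
    (\prod_i (x 0 i - cell_corner a b beta 0 i) ^+ alpha i)%:C%C.
  rewrite /mmonomial rmorph_prod; apply: eq_bigr => i _.
  by rewrite /nat_index ffunE rmorphXn !mxE.
by case: ((rc beta).2 _) => y1 y2 /=; rewrite mulr0 subr0.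
Qed.
(** * Integration over a set of full measure *)

Section integrals_over_a_full_set.
Context (disp : measure_display) (X : measurableType disp) (R : realType).
Variables (mu : probability X R) (Omega : set X).
Hypothesis mOmega : measurable Omega.
Hypothesis muOmega : mu Omega = 1%E.
Implicit Types (f g u v : X -> R).

Definition integrable_on f := mu.-integrable Omega (EFin \o f).

Lemma integrable_onB f g : integrable_on f -> integrable_on g ->
  integrable_on (fun x => f x - g x).
Proof. by move=> If Ig; have := integrableB mOmega If Ig; apply: eq_integrable. Qed.

Lemma integrable_onZ (c : R) f : integrable_on f -> integrable_on (fun x => c * f x).
Proof. by move=> If; have := integrableZl mOmega c If; apply: eq_integrable. Qed.

Lemma integrable_on_sum (I : finType) (F : I -> X -> R) :
  (forall i, integrable_on (F i)) -> integrable_on (fun x => \sum_i F i x).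
Proof.
move=> IF; have := integrable_sum mOmega (index_enum I) (P := xpredT)
  (fun i _ => IF i); apply: eq_integrable => // x _ /=.
by rewrite sumEFin.
Qed.

Lemma integrable_on_norm f : integrable_on f -> integrable_on (fun x => `|f x|).
Proof. by move=> If; exact: integrable_norm. Qed.

Lemma integrable_on_bounded_mul f u (K : R) : measurable_fun Omega f ->
  (forall x, Omega x -> `|f x| <= K) -> integrable_on u ->
  integrable_on (fun x => f x * u x).
Proof.
move=> mf fK Iu; have := integrableMr mOmega mf _ Iu.
have fb : [bounded f x | x in Omega].
  exists K; split=> [|y Ky x Ox]; first exact: num_real.
  exact: le_trans (fK _ Ox) (ltW Ky).
by move=> /(_ fb); apply: eq_integrable.
Qed.

Lemma integrable_on_cst (c : R) : integrable_on (fun=> c).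
Proof. exact: finite_measure_integrable_cst. Qed.

Lemma RintegralS (I : finType) (F : I -> X -> R) : (forall i, integrable_on (F i)) ->
  \int[mu]_(x in Omega) (\sum_i F i x) = \sum_i \int[mu]_(x in Omega) F i x.
Proof.
move=> IF; rewrite /Rintegral.
under eq_integral do rewrite -sumEFin.
rewrite integral_sum//=; rewrite -sum_fine// => i _; exact: integrable_fin_num (IF i).
Qed.

Lemma ae_le_Rintegral f g : integrable_on f -> integrable_on g ->
  {ae mu, forall x, Omega x -> f x <= g x} ->
  \int[mu]_(x in Omega) f x <= \int[mu]_(x in Omega) g x.
Proof.
move=> If Ig fg; rewrite -subr_ge0 -RintegralB//.
have Igf := integrable_onB Ig If.
suff -> : \int[mu]_(x in Omega) (g x - f x) = \int[mu]_(x in Omega) `|g x - f x|.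
  exact: Rintegral_ge0.
congr fine; apply: ae_eq_integral => //.
- by have /measurable_int := Igf.
- by have /measurable_int := integrable_on_norm Igf.
- by apply: filterS fg => x fgx Ox; rewrite ger0_norm// subr_ge0 fgx.
Qed.

Lemma ae_Rintegral_bound f (c : R) u : integrable_on (fun x => f x * u x) ->
  integrable_on u -> {ae mu, forall x, Omega x -> `|f x| <= c} ->
  `|\int[mu]_(x in Omega) (f x * u x)| <= c * \int[mu]_(x in Omega) `|u x|.
Proof.
move=> Ifu Iu fc; rewrite -RintegralZl//; last exact: integrable_on_norm.
apply: le_trans (le_normr_Rintegral mOmega Ifu) _.
apply: ae_le_Rintegral; first exact: integrable_on_norm.
  exact/integrable_onZ/integrable_on_norm.
by apply: filterS fc => x fcx Ox; rewrite normrM ler_wpM2r// fcx.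
Qed.

Lemma Lfun2_integrable_on u : u \in Lfun mu 2%:E -> integrable_on u.
Proof.
move=> Lu; have : u \in Lfun mu 1 by apply: Lfun_subset12 Lu; exact: fin_num_measure.
by move/Lfun1_integrable => Iu; apply: integrableS Iu.
Qed.

Lemma Lfun2_mul_integrable_on u v : u \in Lfun mu 2%:E -> v \in Lfun mu 2%:E ->
  integrable_on (fun x => u x * v x).
Proof.
move=> Lu Lv; have /Lfun1_integrable Iuv := Lfun2_mul_Lfun1 Lu Lv.
exact: integrableS Iuv.
Qed.

(** The variance of [|u|] is nonnegative. *)
Lemma sqr_Rintegral_norm_le u : u \in Lfun mu 2%:E ->
  (\int[mu]_(x in Omega) `|u x|) ^+ 2 <= \int[mu]_(x in Omega) (u x * u x).
Proof.
move=> Lu; set m := \int[mu]_(x in Omega) _.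
have Iu := integrable_on_norm (Lfun2_integrable_on Lu).
have Iuu := Lfun2_mul_integrable_on Lu Lu.
have : 0 <= \int[mu]_(x in Omega) (u x * u x - (2 * m * `|u x| - m ^+ 2)).
  apply: Rintegral_ge0 => x _.
  suff -> : u x * u x - (2 * m * `|u x| - m ^+ 2) = (`|u x| - m) ^+ 2 by exact: sqr_ge0.
  by rewrite sqrrB -[u x * u x]/(u x ^+ 2) -[u x ^+ 2]real_normK ?num_real//; ring.
have I1 := integrable_onZ (2 * m) Iu; have I2 := integrable_on_cst (m ^+ 2).
rewrite RintegralB//; last exact: integrable_onB.
have Ic : \int[mu]_(x in Omega) (m ^+ 2) = m ^+ 2.
  by rewrite Rintegral_cst// (_ : fine _ = 1) ?mulr1//; exact: congr1 muOmega.
rewrite RintegralB// RintegralZl// Ic -/m.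
rewrite -mulrA -expr2; lra.
Qed.

Lemma Rintegral_sqr_eq0 u : u \in Lfun mu 2%:E ->
  \int[mu]_(x in Omega) (u x * u x) = 0 -> {ae mu, forall x, Omega x -> u x = 0}.
Proof.
move=> Lu I0; have Iuu := Lfun2_mul_integrable_on Lu Lu.
have : (\int[mu]_(x in Omega) `|(u x * u x)%:E| = 0)%E.
  transitivity (\int[mu]_(x in Omega) (u x * u x)%:E)%E.
    by apply: eq_integral => x _; rewrite /= ger0_norm// -expr2 sqr_ge0.
  by rewrite -[LHS]fineK ?integrable_fin_num// -/(Rintegral _ _ _) I0.
move/ae_eq_integral_abs => /(_ mOmega (measurable_int _ Iuu)).
apply: filterS => x h Ox; have [/eqP] := h Ox.
by rewrite mulf_eq0 orbb => /eqP.
Qed.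

Lemma ae_on_Omega (P : X -> Prop) :
  {ae mu, forall x, Omega x -> P x} -> {ae mu, forall x, P x}.
Proof.
have aO : {ae mu, forall x, Omega x}.
  exists (~` Omega); split => //; first exact: measurableC.
  by rewrite probability_setC// muOmega subee.
by move=> h; apply: filterS2 aO h => x Ox; exact.
Qed.

Lemma Lfun2_sum (I : finType) (P : pred I) (s : I -> R) (F : I -> X -> R) :
  (forall i, F i \in Lfun mu 2%:E) ->
  (fun x => \sum_(i | P i) s i * F i x) \in Lfun mu 2%:E.
Proof.
move=> LF; have -> : (fun x => \sum_(i | P i) s i * F i x) = \sum_(i | P i) s i *: F i.
  by apply/funext => x; rewrite fct_sumE.
have p1 : (1 <= 2%:E :> \bar R)%E by rewrite lee1n.
have [L0 LD] := Lfun_submod_closed mu p1.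
by elim/big_rec : _ => [//|i f _ Lf]; exact: LD.
Qed.

End integrals_over_a_full_set.
(** * Integral operators with symmetric kernels *)

Section symmetric_kernel.
Context (disp : measure_display) (X : measurableType disp) (R : realType).
Variables (mu : probability X R) (Omega : set X).
Hypothesis mOmega : measurable Omega.
Hypothesis muOmega : mu Omega = 1%E.
Variables (k : X -> X -> R) (K : R).
Hypothesis ksym : forall x y, k x y = k y x.
Hypothesis kK : forall x y, Omega x -> Omega y -> `|k x y| <= K.
Hypothesis kstep : forall e : R, 0 < e ->
  exists (I : finType) (u : I -> X -> R) (w : I -> X),
    [/\ forall i, measurable_fun Omega (u i),
        exists B, forall i x, Omega x -> `|u i x| <= B,
        forall i, Omega (w i)
      & forall x y, Omega x -> Omega y ->
          `|k x y - \sum_i u i x * k (w i) y| <= e].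

Definition kernel_op (v : X -> R) (x : X) : R :=
  \int[mu]_(y in Omega) (k x y * v y).

Lemma measurable_kernel x : Omega x -> measurable_fun Omega (k x).
Proof.
move=> Ox; have -> : k x = k ^~ x by apply/funext => y; exact: ksym.
have /choice[h hP] : forall n, exists h : X -> R, measurable_fun Omega h /\
    forall y, Omega y -> `|k y x - h y| <= n.+1%:R^-1.
  move=> n; have [|I [u [w [mu' _ Ow kuw]]]] := @kstep n.+1%:R^-1.
    by rewrite invr_gt0 ltr0n.
  exists (fun y => \sum_i u i y * k (w i) x); split=> [|y Oy]; last exact: kuw.
  apply: measurable_sum => i; apply: measurable_funM => //.
apply: (@measurable_fun_cvg _ _ _ _ h) => [n|y Oy]; first by have [] := hP n.
apply/cvgrPdist_le => e e0; near=> n.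
have [_ /(_ y Oy)] := hP n; move/le_trans; apply.
by rewrite ltW//; near: n; exact: near_infty_natSinv_lt (PosNum e0).
Unshelve. all: by end_near. Qed.

Lemma kernel_mul_integrable x v : Omega x -> integrable_on mu Omega v ->
  integrable_on mu Omega (fun y => k x y * v y).
Proof.
move=> Ox Iv; apply: (@integrable_on_bounded_mul _ _ _ _ _ _ _ _ K) => //.
  exact: measurable_kernel.
by move=> y Oy; exact: kK.
Qed.

(** Approximating the section [k x] approximates [kernel_op v x] by a
    combination of the moments of [v] against the [f j].  The coefficients may
    depend on [x] in a nonmeasurable way: only the value at [x] is used. *)
Lemma kernel_op_approx (J : finType) (f : J -> X -> R) (s : J -> R) (e : R) x v :
  Omega x -> integrable_on mu Omega v ->
  (forall j, integrable_on mu Omega (fun y => f j y * v y)) ->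
  (forall y, Omega y -> `|k x y - \sum_j s j * f j y| <= e) ->
  `|kernel_op v x - \sum_j s j * \int[mu]_(y in Omega) (f j y * v y)|
    <= e * \int[mu]_(y in Omega) `|v y|.
Proof.
move=> Ox Iv If ke.
have Isf j := integrable_onZ mOmega (s j) (If j).
have -> : \sum_j s j * \int[mu]_(y in Omega) (f j y * v y) =
    \int[mu]_(y in Omega) (\sum_j s j * (f j y * v y)).
  by rewrite RintegralS//; apply: eq_bigr => j _; rewrite RintegralZl//; exact: If.
have Ikv := kernel_mul_integrable Ox Iv.
have Isum := integrable_on_sum mOmega Isf.
rewrite /kernel_op -RintegralB//.
have E : (fun y => k x y * v y - \sum_j s j * (f j y * v y)) =
    (fun y => (k x y - \sum_j s j * f j y) * v y).
  apply/funext => y; rewrite mulrBl mulr_suml; congr (_ - _).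
  by apply: eq_bigr => j _; rewrite mulrA.
have Idiff := integrable_onB mOmega Ikv Isum; rewrite E in Idiff.
rewrite [X in Rintegral _ _ X]E.
by apply: ae_Rintegral_bound => //; apply: aeW => y Oy; exact: ke.
Qed.

Lemma Rintegral_mul_comb (J : finType) (f : J -> X -> R) (c : J -> R) (l : R)
    (u v : X -> R) :
  integrable_on mu Omega (fun x => u x * v x) ->
  (forall j, integrable_on mu Omega (fun x => f j x * v x)) ->
  integrable_on mu Omega (fun x => (l * u x - \sum_j c j * f j x) * v x) /\
  \int[mu]_(x in Omega) ((l * u x - \sum_j c j * f j x) * v x) =
    l * \int[mu]_(x in Omega) (u x * v x)
    - \sum_j c j * \int[mu]_(x in Omega) (f j x * v x).
Proof.
move=> Iuv If.
have E : (fun x => (l * u x - \sum_j c j * f j x) * v x) =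
    (fun x => l * (u x * v x) - \sum_j c j * (f j x * v x)).
  apply/funext => x; rewrite mulrBl mulrA mulr_suml; congr (_ - _).
  by apply: eq_bigr => j _; rewrite mulrA.
have I1 := integrable_onZ mOmega l Iuv.
have Isf j := integrable_onZ mOmega (c j) (If j).
have I2 := integrable_on_sum mOmega Isf.
rewrite E; split; first exact: integrable_onB.
rewrite RintegralB// RintegralZl// RintegralS//; congr (_ - _).
by apply: eq_bigr => j _; rewrite RintegralZl//; exact: If.
Qed.

(** Let [c i], [c' i] be the integrals of [k (w i) * u] and [u i * v] for an
    approximation of [k] by [\sum_i u i x * k (w i) y] with error [e].  Both
    [l <u, v>] and [m <u, v>] differ from [\sum_i c i * c' i] by [O(e)]: the
    first is reached by expanding the operator applied to [u], the second by
    expanding the operator applied to [v] with the roles of the variables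
    exchanged by symmetry.  This replaces the use of Fubini's theorem. *)
Lemma eigenvectors_orthogonal (l m : R) (u v : X -> R) : l != m ->
  in_eigenspace mu kernel_op l u -> in_eigenspace mu kernel_op m v ->
  \int[mu]_(x in Omega) (u x * v x) = 0.
Proof.
move=> lm [Lu Tu] [Lv Tv].
have Iu := Lfun2_integrable_on mOmega Lu; have Iv := Lfun2_integrable_on mOmega Lv.
have Iuv := Lfun2_mul_integrable_on mOmega Lu Lv.
have Ivu := Lfun2_mul_integrable_on mOmega Lv Lu.
set a := \int[mu]_(x in Omega) (u x * v x).
have aE : a = \int[mu]_(x in Omega) (v x * u x).
  by apply: eq_Rintegral => x _; rewrite mulrC.
pose U := \int[mu]_(x in Omega) `|u x|; pose V := \int[mu]_(x in Omega) `|v x|.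
have U0 : 0 <= U by apply: Rintegral_ge0.
have V0 : 0 <= V by apply: Rintegral_ge0.
suff bound (e : R) : 0 < e -> `|(l - m) * a| <= 2 * (e * (U * V)).
  have lma : `|(l - m) * a| <= 0.
    apply/ler_addgt0Pr => e e0; rewrite add0r.
    have D0 : 0 < 2 * (U * V + 1) by rewrite mulr_gt0// ltr_wpDl// mulr_ge0.
    rewrite (le_trans (bound (e / (2 * (U * V + 1))) _)) ?divr_gt0//.
    rewrite mulrCA mulrAC ler_pdivrMr// ler_wpM2l ?(ltW e0)//.
    by rewrite ler_wpM2l// lerDl.
  move: lma; rewrite normr_le0 mulf_eq0 subr_eq0 (negbTE lm)/=.
  by move/eqP.
move=> e0; have [J [f [w [mf [B fB] Ow kfw]]]] := kstep e0.
have If g i : integrable_on mu Omega g ->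
    integrable_on mu Omega (fun x => f i x * g x).
  by move=> Ig; apply: (@integrable_on_bounded_mul _ _ _ _ _ _ _ _ B) => // x; exact: fB.
have Ik g i : integrable_on mu Omega g ->
    integrable_on mu Omega (fun x => k (w i) x * g x).
  exact: kernel_mul_integrable.
pose c i := \int[mu]_(y in Omega) (k (w i) y * u y).
pose c' i := \int[mu]_(x in Omega) (f i x * v x).
have [J1 E1] := @Rintegral_mul_comb _ f c l u v Iuv (fun i => If v i Iv).
have [J2 E2] := @Rintegral_mul_comb _ (fun i => k (w i)) c' m v u Ivu
  (fun i => Ik u i Iu).
have b1 : `|l * a - \sum_i c i * c' i| <= e * U * V.
  rewrite -E1; apply: ae_Rintegral_bound => //.
  apply: filterS Tu => x Tux Ox; rewrite -(Tux I).
  under eq_bigr do rewrite mulrC.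
  apply: kernel_op_approx => // [i|y Oy]; [exact: Ik|exact: kfw].
have b2 : `|m * a - \sum_i c i * c' i| <= e * V * U.
  under eq_bigr do rewrite mulrC.
  rewrite aE -E2; apply: ae_Rintegral_bound => //.
  apply: filterS Tv => x Tvx Ox; rewrite -(Tvx I).
  under eq_bigr do rewrite mulrC.
  apply: kernel_op_approx => // [i|y Oy]; first exact: If.
  rewrite ksym; under eq_bigr do rewrite mulrC. exact: kfw.
have -> : (l - m) * a = (l * a - \sum_i c i * c' i) - (m * a - \sum_i c i * c' i).
  by ring.
rewrite (le_trans (ler_normB _ _))// (le_trans (lerD b1 b2))//.
by rewrite le_eqVlt; apply/orP; left; apply/eqP; ring.
Qed.

End symmetric_kernel.
(** The bases of the eigenspaces are glued into one sequence along the
    bijections between basis indices and occurrences of the eigenvalue in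
    [tau]; independence is kept within each eigenvalue, as orthogonality takes
    care of the rest. *)
Lemma eigenvector_family (disp : measure_display) (X : measurableType disp)
    (R : realType) (mu : {measure set X -> \bar R}) (T : (X -> R) -> X -> R)
    (tau : R^nat) : eigenvalue_seq mu T tau ->
  exists w : nat -> X -> R, forall i, tau i != 0 ->
    in_eigenspace mu T (tau i) (w i) /\
    forall (n : nat) (s : 'I_n -> R),
      (fun x => \sum_(j < n | tau j == tau i) s j * w j x) = cst 0 %[ae mu] ->
      forall j : 'I_n, tau j = tau i -> s j = 0.
Proof.
move=> [_ _ taueig].
have /choice[W WP] : forall l, exists w : nat -> X -> R, l != 0 ->
    (forall i, tau i = l -> in_eigenspace mu T l (w i)) /\
    forall (n : nat) (s : 'I_n -> R),
      (fun x => \sum_(j < n | tau j == l) s j * w j x) = cst 0 %[ae mu] ->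
      forall j : 'I_n, tau j = l -> s j = 0.
  move=> l; have [->|l0] := eqVneq l 0; first by exists (fun _ => cst 0).
  have [m [v [[vT vfree _] /card_set_bijP[f [ffun_ finj_ _]]]]] := taueig l l0.
  pose w i x := \sum_(p < m) (p == f i :> nat)%:R * v p x.
  have fm i : tau i = l -> (f i < m)%N.
    by move=> taui; exact: ffun_.
  have finj i j : tau i = l -> tau j = l -> f i = f j -> i = j.
    by move=> ti tj; apply: finj_; rewrite inE.
  exists w => _; split=> [i taui|n s ws j tauj].
    suff -> : w i = v (Ordinal (fm i taui)) by exact: vT.
    apply/funext => x; rewrite /w (bigD1 (Ordinal (fm i taui)))//= eqxx mul1r.
    rewrite big1 ?addr0// => p pi.
    by rewrite (_ : (_ == _) = false) ?mul0r//; apply: contraNF pi.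
  pose s' (p : 'I_m) := \sum_(j < n | tau j == l) s j * (p == f j :> nat)%:R.
  have /vfree s'0 : (fun x => \sum_i s' i * v i x) = cst 0 %[ae mu].
    apply: filterS ws => x /(_ I) wsx _; rewrite -wsx.
    under eq_bigr do rewrite mulr_suml.
    rewrite exchange_big/=; apply: eq_bigr => i _.
    by rewrite /w mulr_sumr; apply: eq_bigr => p _; rewrite mulrA.
  have := s'0 (Ordinal (fm j tauj)); rewrite /s' (bigD1 j)/= ?tauj//.
  rewrite eqxx mulr1 big1 ?addr0// => i /andP[/eqP taui ij].
  rewrite (_ : (_ == _) = false) ?mulr0//; apply: contraNF ij => /eqP fij.
  by apply/eqP/val_inj/finj.
exists (fun i => W (tau i) i) => i taui; have [Weig Wfree] := WP _ taui.
split; first exact: Weig.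
move=> n s ws; apply: Wfree; apply: filterS ws => x h _; rewrite -(h I).
by apply: eq_bigr => j /eqP ->.
Qed.

Section eigenvalue_bound.
Context (disp : measure_display) (X : measurableType disp) (R : realType).
Variables (mu : probability X R) (Omega : set X).
Hypothesis mOmega : measurable Omega.
Hypothesis muOmega : mu Omega = 1%E.

Lemma Rintegral_quadratic (n : nat) (w : 'I_n -> X -> R) (a b : 'I_n -> R) :
  (forall i, w i \in Lfun mu 2%:E) ->
  \int[mu]_(x in Omega) ((\sum_i a i * w i x) * (\sum_i b i * w i x)) =
  \sum_i \sum_j a i * b j * \int[mu]_(x in Omega) (w i x * w j x).
Proof.
move=> Lw.
have Iw i j := Lfun2_mul_integrable_on mOmega (Lw i) (Lw j).
have Iab i j := integrable_onZ mOmega (a i * b j) (Iw i j).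
transitivity (\sum_i \int[mu]_(x in Omega) (\sum_j a i * b j * (w i x * w j x))).
  rewrite -RintegralS//; last by move=> i; exact: integrable_on_sum (Iab i).
  apply: eq_Rintegral => x _; rewrite mulr_suml; apply: eq_bigr => i _.
  by rewrite mulr_sumr; apply: eq_bigr => j _; rewrite mulrACA.
apply: eq_bigr => i _; rewrite RintegralS//.
by apply: eq_bigr => j _; rewrite RintegralZl//; exact: Iw.
Qed.

Variables (k : X -> X -> R) (K : R).
Hypothesis ksym : forall x y, k x y = k y x.
Hypothesis kK : forall x y, Omega x -> Omega y -> `|k x y| <= K.
Hypothesis kstep : forall e : R, 0 < e ->
  exists (I : finType) (u : I -> X -> R) (w : I -> X),
    [/\ forall i, measurable_fun Omega (u i),
        exists B, forall i x, Omega x -> `|u i x| <= B,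
        forall i, Omega (w i)
      & forall x y, Omega x -> Omega y ->
          `|k x y - \sum_i u i x * k (w i) y| <= e].

(** A combination [v] of the first [n + 1] eigenvectors orthogonal to all the
    [f i] is sent to a function bounded by [e] times the integral of [|v|], so
    of norm at most [e] times that of [v].  By orthogonality of the eigenspaces
    the operator multiplies the norm of [v] by at least [tau n]. *)
Theorem eigenvalue_le_approximation (tau : R^nat) (J : finType) (f : J -> X -> R)
    (B e : R) (n : nat) :
  eigenvalue_seq mu (kernel_op mu Omega k) tau -> 0 <= e ->
  (forall i, measurable_fun Omega (f i)) ->
  (forall i x, Omega x -> `|f i x| <= B) ->
  (forall y, Omega y -> exists s : J -> R, forall x, Omega x ->
     `|k x y - \sum_i s i * f i x| <= e) ->
  (#|J| <= n)%N -> tau n <= e.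
Proof.
move=> taueig e0 mf fB kf Jn; have [tau_decr tau0 _] := taueig.
have [tn0|tn0] := leP (tau n) 0; first exact: le_trans e0.
have taun i : (i < n.+1)%N -> tau n <= tau i by rewrite ltnS => /tau_decr.
have taupos i : (i < n.+1)%N -> tau i != 0.
  by move=> /taun; move=> /(lt_le_trans tn0)/gt_eqF ->.
have [w0 w0P] := eigenvector_family taueig.
pose w (i : 'I_n.+1) := w0 i.
have weig (i : 'I_n.+1) : in_eigenspace mu (kernel_op mu Omega k) (tau i) (w i).
  by have [] := w0P i (taupos i (ltn_ord i)).
have Lw i : w i \in Lfun mu 2%:E by have [] := weig i.
have Iw i := Lfun2_integrable_on mOmega (Lw i).
have worth (i j : 'I_n.+1) : tau i != tau j ->
    \int[mu]_(x in Omega) (w i x * w j x) = 0.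
  move=> tij; exact: (eigenvectors_orthogonal mOmega ksym kK kstep tij).
have Ifw g : integrable_on mu Omega g ->
    forall p, integrable_on mu Omega (fun x => f p x * g x).
  move=> Ig p; apply: (@integrable_on_bounded_mul _ _ _ _ _ _ _ _ B) => // x; exact: fB.
(* The n + 1 rows of A lie in a space of dimension #|J| <= n, so they satisfy a
   nontrivial linear relation s. *)
pose A := \matrix_(i < n.+1, q < #|J|)
  \int[mu]_(x in Omega) (f (enum_val q) x * w i x).
have /rowV0Pn[s /sub_kermxP sA s0] : kermx A != 0.
  by rewrite -mxrank_eq0 mxrank_ker subn_eq0 -ltnNge (leq_ltn_trans (rank_leq_col _)).
pose v x := \sum_i s 0 i * w i x.
have Lv : v \in Lfun mu 2%:E by exact: Lfun2_sum.
have Iv := Lfun2_integrable_on mOmega Lv.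
have fv p : \int[mu]_(x in Omega) (f p x * v x) = 0.
  have /matrixP/(_ 0 (enum_rank p)) := sA; rewrite !mxE => sAp.
  rewrite -[RHS]sAp.
  have -> : \int[mu]_(x in Omega) (f p x * v x) =
      \int[mu]_(x in Omega) (\sum_i s 0 i * (f p x * w i x)).
    apply: eq_Rintegral => x _; rewrite mulr_sumr.
    by apply: eq_bigr => i _; rewrite mulrCA.
  rewrite RintegralS//; last by move=> i; exact/(integrable_onZ mOmega)/Ifw.
  apply: eq_bigr => i _; rewrite RintegralZl//; last exact: Ifw.
  by rewrite mxE enum_rankK.
pose N1 := \int[mu]_(x in Omega) `|v x|.
pose q x := \sum_(i < n.+1) (s 0 i * tau i) * w i x.
have Lq : q \in Lfun mu 2%:E by exact: Lfun2_sum.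
have qbound : {ae mu, forall x, Omega x -> `|q x| <= e * N1}.
  have : {ae mu, forall x, forall i, kernel_op mu Omega k (w i) x = tau i * w i x}.
    apply: filter_forall => i; have [_] := weig i.
    by apply: filterS => x; apply.
  apply: filterS => x wx Ox.
  have -> : q x = kernel_op mu Omega k v x.
    rewrite /kernel_op.
    transitivity (\int[mu]_(y in Omega) (\sum_i s 0 i * (k x y * w i y))).
      have Ikw i := kernel_mul_integrable mOmega ksym kK kstep Ox (Iw i).
      rewrite RintegralS//; last by move=> i; exact: integrable_onZ.
      apply: eq_bigr => i _; rewrite RintegralZl//; last exact: Ikw.
      by rewrite -mulrA -wx.
    apply: eq_Rintegral => y _; rewrite mulr_sumr.
    by apply: eq_bigr => i _; rewrite mulrCA.
  have [c kc] := kf x Ox.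
  have := @kernel_op_approx _ _ _ _ _ mOmega _ _ ksym kK kstep
    J f c e x v Ox Iv (Ifw v Iv).
  rewrite big1 ?subr0 => [|p _]; last by rewrite fv mulr0.
  by apply => y Oy; rewrite ksym; exact: kc.
have N10 : 0 <= N1 by exact: Rintegral_ge0.
have qq : \int[mu]_(x in Omega) (q x * q x)
    <= e ^+ 2 * \int[mu]_(x in Omega) (v x * v x).
  apply: (@le_trans _ _ ((e * N1) ^+ 2)); last first.
    by rewrite exprMn ler_wpM2l ?sqr_ge0// sqr_Rintegral_norm_le.
  have -> : (e * N1) ^+ 2 = \int[mu]_(x in Omega) ((e * N1) ^+ 2).
    by rewrite Rintegral_cst// (_ : fine _ = 1) ?mulr1//; exact: congr1 muOmega.
  apply: ae_le_Rintegral => //.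
  - exact: Lfun2_mul_integrable_on.
  - exact: integrable_on_cst.
  apply: filterS qbound => x qx Ox; rewrite -expr2 -[q x ^+ 2]real_normK ?num_real//.
  by rewrite lerXn2r ?nnegrE ?mulr_ge0// qx.
(* On the support of the Gram matrix tau i = tau j, so tau i * tau j - tau n ^ 2
   factors as sigma i * sigma j, and the difference of the two sides is the
   integral of the square of z. *)
pose sigma (i : 'I_n.+1) := Num.sqrt (tau i ^+ 2 - tau n ^+ 2).
pose z x := \sum_(i < n.+1) (s 0 i * sigma i) * w i x.
have qq_lower : tau n ^+ 2 * \int[mu]_(x in Omega) (v x * v x)
    <= \int[mu]_(x in Omega) (q x * q x).
  have zz : 0 <= \int[mu]_(x in Omega) (z x * z x).
    by apply: Rintegral_ge0 => x _; rewrite -expr2 sqr_ge0.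
  rewrite -subr_ge0; apply: etrans zz; congr (0 <= _); rewrite !Rintegral_quadratic//.
  rewrite mulr_sumr -sumrB; apply: eq_bigr => i _.
  rewrite mulr_sumr -sumrB; apply: eq_bigr => j _.
  have [tij|/worth ->] := eqVneq (tau i) (tau j); last by rewrite !mulr0 subrr.
  rewrite /sigma -tij.
  have : Num.sqrt (tau i ^+ 2 - tau n ^+ 2) ^+ 2 = tau i ^+ 2 - tau n ^+ 2.
    by rewrite sqr_sqrtr// subr_ge0 lerXn2r ?nnegrE ?tau0// taun.
  set r := Num.sqrt _; set G := \int[mu]_(x in Omega) _ => rr.
  have -> : s 0 i * r * (s 0 j * r) * G = s 0 i * s 0 j * r ^+ 2 * G by ring.
  by rewrite rr; ring.
have vv : 0 < \int[mu]_(x in Omega) (v x * v x).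
  rewrite lt_def; apply/andP; split; last first.
    by apply: Rintegral_ge0 => x _; rewrite -expr2 sqr_ge0.
  apply: contra s0 => /eqP /(Rintegral_sqr_eq0 mOmega Lv) v0.
  apply/eqP/rowP => i0; rewrite mxE.
  (* vl is the component of v in the eigenspace of w i0: it inherits v = 0 by
     orthogonality, and then the basis property gives s i0 = 0. *)
  pose sl (i : 'I_n.+1) := s 0 i * (tau i == tau i0)%:R.
  pose vl x := \sum_i sl i * w i x.
  have Lvl : vl \in Lfun mu 2%:E by exact: Lfun2_sum.
  have vlvl : \int[mu]_(x in Omega) (vl x * vl x) = \int[mu]_(x in Omega) (v x * vl x).
    rewrite !Rintegral_quadratic//; apply: eq_bigr => i _; apply: eq_bigr => j _.
    have [tij|/worth ->] := eqVneq (tau i) (tau j); last by rewrite !mulr0.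
    by rewrite /sl -tij; case: eqP => _; rewrite ?mulr0 ?mulr1.
  have vl0 : \int[mu]_(x in Omega) (vl x * vl x) = 0.
    apply/eqP; rewrite -normr_le0 vlvl.
    rewrite -(mul0r (\int[mu]_(x in Omega) `|vl x|)).
    apply: ae_Rintegral_bound => //; first exact: Lfun2_mul_integrable_on.
      exact: Lfun2_integrable_on.
    by apply: filterS v0 => x v0x Ox; rewrite v0x// normr0.
  have [_ wfree] := w0P i0 (taupos i0 (ltn_ord i0)).
  apply: (wfree n.+1 (fun i => s 0 i)) => //.
  have := ae_on_Omega mOmega muOmega (Rintegral_sqr_eq0 mOmega Lvl vl0).
  apply: filterS => x vlx _; rewrite -[RHS]vlx /vl big_mkcond/=.
  by apply: eq_bigr => i _; rewrite /sl; case: eqP => _; rewrite ?mulr1// mulr0 mul0r.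
have := le_trans qq_lower qq; rewrite ler_pM2r//.
by rewrite ler_sqr ?nnegrE ?tau0.
Qed.

End eigenvalue_bound.
(** * Eigenvalue decay *)

Lemma open_box_lt (R : realType) (d : nat) (a b : 'rV[R]_d) (Omega : set 'rV[R]_d) :
  open Omega -> Omega !=set0 -> Omega `<=` box a b -> forall i, a 0 i < b 0 i.
Proof.
move=> oO [x Ox] Obox i.
have /nbhs_ballP[e /= e0 eO] : nbhs x Omega by exact: open_nbhs_nbhs.
have /Obox/(_ i)/andP[_] : Omega (x + (e / 2) *: delta_mx 0 i).
  apply: eO; split=> // i' j'; rewrite (ord1 i') /ball/= !mxE opprD addNKr normrN.
  rewrite normrM gtr0_norm ?divr_gt0//.
  case: (_ && _); rewrite ?normr1 ?normr0 ?mulr1 ?mulr0//; lra.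
have /andP[+ _] := Obox _ Ox i.
rewrite !mxE !eqxx mulr1; lra.
Qed.

Lemma cell_monomial_bounded (R : realType) (d : nat) (a b : 'rV[R]_d) (M N : nat) :
  exists B, forall (beta : {ffun 'I_d -> 'I_M.+1}) (alpha : {ffun 'I_d -> 'I_N}) x,
    `|cell_monomial a b beta alpha x| <= B.
Proof.
pose W (alpha : {ffun 'I_d -> 'I_N}) := \prod_i `|cell_width a b M i| ^+ alpha i.
have W0 alpha : 0 <= W alpha by apply: prodr_ge0 => i _; exact: exprn_ge0.
exists (\sum_alpha W alpha) => beta alpha x.
apply: (@le_trans _ _ (W alpha)); last by rewrite (bigD1 alpha)//= lerDl sumr_ge0.
rewrite /cell_monomial normr_prod; apply: ler_prod => i _.
rewrite normr_ge0/= normrM indicE.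
case: (boolP (_ \in _)) => [/set_mem|_]; last by rewrite normr0 mul0r exprn_ge0.
rewrite /cell_side /= in_itv/= => /andP[h1 h2].
rewrite normr1 mul1r normrX lerXn2r ?nnegrE// ger0_norm ?subr_ge0//.
by rewrite (le_trans _ (ler_norm _))// lerBlDl ltW.
Qed.

Lemma bounded_extension_le (R : realType) (d : nat) (a b : 'rV[R]_d) (r C : R)
    (Omega : set 'rV[R]_d) (g : 'rV[R]_d -> R) :
  (forall i, a 0 i < b 0 i) -> 1 < r -> Omega `<=` box a b ->
  bounded_analytic_extension Omega (polyellipse a b r) C g ->
  forall x, Omega x -> `|g x| <= C.
Proof.
move=> ab r1 Obox [f [_ fg fC]] x Ox.
rewrite -normc_real -fg//; apply: fC.
apply: polyellipse_near (Obox _ Ox) _ => // i.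
rewrite mxE subrr normc0 mulr_gt0 ?ellipse_margin_gt0// divr_gt0// subr_gt0//.
Qed.

Lemma fine_mesh (R : realType) (r rho : R) : 1 < r ->
  exists M, 2 * rho < ellipse_margin r * M%:R.
Proof.
move=> r1; have m0 := ellipse_margin_gt0 r1.
exists (Num.truncn (2 * rho / ellipse_margin r)).+1.
by rewrite [ltRHS]mulrC -ltr_pdivrMr// truncnS_gt.
Qed.

(** Piecewise constant approximation ([N = 1]) of relative accuracy [2 / rho]
    with [rho] large shows that two points of [Omega] in the same cell give
    values of [k] that differ by at most [e]; so [k x y] may be replaced by
    [k w y], where [w] is a point of [Omega] chosen once for all in the cell of
    [x]. *)
Lemma kernel_step_approximation (R : realType) (d : nat) (a b : 'rV[R]_d) (r C e : R)
    (Omega : set 'rV[R]_d) (k : 'rV[R]_d -> 'rV[R]_d -> R) :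
  (forall i, a 0 i < b 0 i) -> 1 < r -> 0 < C -> Omega !=set0 -> Omega `<=` box a b ->
  (forall y, Omega y ->
     bounded_analytic_extension Omega (polyellipse a b r) C (k ^~ y)) ->
  0 < e ->
  exists (I : finType) (u : I -> 'rV[R]_d -> R) (w : I -> 'rV[R]_d),
    [/\ forall i, measurable_fun (Omega : set (borel 'rV[R]_d)) (u i),
        exists B, forall i x, Omega x -> `|u i x| <= B,
        forall i, Omega (w i)
      & forall x y, Omega x -> Omega y ->
          `|k x y - \sum_i u i x * k (w i) y| <= e].
Proof.
move=> ab r1 C0 [x0 Ox0] Obox kext e0.
(* The triangle inequality through the constant of the cell costs
   2 * C * (2 / rho), which is at most e for this rho. *)
pose rho := 1 + 4 * C / e.
have rho1 : 1 <= rho by rewrite lerDl divr_ge0 ?mulr_ge0// ltW.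
have rho0 : 0 < rho := lt_le_trans ltr01 rho1.
have [M rhoM] := fine_mesh rho r1.
have M0 : (0 < M)%N.
  by rewrite lt0n; apply: contraTneq rhoM => ->; rewrite mulr0 -leNgt; lra.
pose in_cell (beta : {ffun 'I_d -> 'I_M.+1}) (x : 'rV[R]_d) :=
  forall i, cell_side a b beta i (x 0 i).
have same_cell beta x x' y : Omega x -> Omega x' -> Omega y ->
    in_cell beta x -> in_cell beta x' -> `|k x y - k x' y| <= e.
  move=> Ox Ox' Oy bx bx'.
  have [s hs] := cell_approximation 1 ab r1 rho1 rhoM Obox (kext _ Oy).
  have := hs _ Ox; have := hs _ Ox'.
  have -> : \sum_beta \sum_alpha s beta alpha * cell_monomial a b beta alpha x' =
     \sum_beta \sum_alpha s beta alpha * cell_monomial a b beta alpha x.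
    apply: eq_bigr => beta' _; apply: eq_bigr => alpha _; congr (_ * _).
    have [beta0 beta0P] := box_in_cell ab M0 (Obox _ Ox).
    have [beta1 beta1P] := box_in_cell ab M0 (Obox _ Ox').
    have E : beta1 = beta0.
      by have <- := (beta0P beta).2 bx; rewrite ((beta1P beta).2 bx').
    have [bb'|bb'] := eqVneq beta' beta0.
      rewrite !cell_monomial_in; [|exact/beta0P|by apply/beta1P; rewrite E].
      by apply: eq_bigr => i _; rewrite (ord1 (alpha i)).
    rewrite !cell_monomial_out//; first by move/beta0P/eqP; rewrite (negbTE bb').
    by move/beta1P/eqP; rewrite E (negbTE bb').
  set S := \sum_beta _ => h' h.
  have -> : k x y - k x' y = (k x y - S) - (k x' y - S) by ring.
  rewrite (le_trans (ler_normB _ _))// (le_trans (lerD h h'))// expr1.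
  have : C * (2 / rho) * 2 <= e; last by lra.
  have erho : e * rho = e + 4 * C by rewrite /rho; field; rewrite gt_eqF.
  by rewrite mulrA mulrAC ler_pdivrMr// erho; lra.
have /choice[w wP] : forall beta, exists w, Omega w /\
    forall x, Omega x -> in_cell beta x -> in_cell beta w.
  move=> beta; have [[x [Ox bx]]|nx] := pselect (exists x, Omega x /\ in_cell beta x).
    by exists x.
  by exists x0; split=> // x Ox bx; exfalso; apply: nx; exists x.
have [B HB] := cell_monomial_bounded a b M 1.
exists {ffun 'I_d -> 'I_M.+1}, (fun beta => cell_monomial a b beta [ffun=> @ord0 0]), w.
split.
- by move=> beta; apply: measurable_funTS; exact: measurable_cell_monomial.
- by exists B => beta x _; exact: HB.
- by move=> beta; have [] := wP beta.
- move=> x y Ox Oy.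
  have [beta betaP] := box_in_cell ab M0 (Obox _ Ox).
  have bx : in_cell beta x by apply/betaP.
  rewrite (bigD1 beta)//=.
  rewrite [X in _ - (_ + X)]big1 ?addr0 => [|beta' /eqP b'b]; last first.
    by rewrite cell_monomial_out ?mul0r// => /betaP.
  rewrite cell_monomial_in// big1 ?mul1r => [|i _]; last by rewrite ffunE expr0.
  have [Ow bw] := wP beta.
  by apply: (same_cell beta) => //; exact: (bw x).
Qed.

Lemma nat_power_bracket (m d n : nat) : (0 < d)%N -> (0 < m)%N ->
  exists N, ((m * N) ^ d <= n < (m * N.+1) ^ d)%N.
Proof.
move=> d0 m0.
have ex : exists N, (n < (m * N.+1) ^ d)%N.
  exists n; apply: (@leq_trans (n.+1 ^ d)); last by rewrite leq_exp2r// leq_pmull.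
  by case: d d0 => // d _; rewrite expnS leq_pmulr// expn_gt0.
exists (ex_minn ex); case: ex_minnP => -[|N] hN minN; rewrite hN andbT.
  by rewrite muln0 exp0n.
by rewrite leqNgt; apply/negP => /minN; rewrite ltnn.
Qed.

(** With [j <= (m * N.+1) ^ d] one has [N.+1 >= j ^ (1/d) / m]; the factor [2]
    pays for the difference between [N] and [N.+1]. *)
Lemma exponential_rate (R : realType) (m d N j : nat) : (0 < d)%N -> (0 < m)%N ->
  (j <= (m * N.+1) ^ d)%N ->
  2^-1 ^+ N <= 2 * expR (- (ln 2 / m%:R) * (j%:R `^ (d%:R)^-1)) :> R.
Proof.
move=> d0 m0 jN; have mR : 0 < m%:R :> R by rewrite ltr0n.
have jroot : j%:R `^ (d%:R)^-1 <= m%:R * N.+1%:R :> R.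
  apply: (@le_trans _ _ (((m * N.+1) ^ d)%:R `^ (d%:R)^-1)).
    by apply: ge0_ler_powR; rewrite ?invr_ge0 ?nnegrE ?ler0n ?ler_nat.
  rewrite natrX -powR_mulrn ?ler0n// -powRrM mulfV ?pnatr_eq0 -?lt0n// powRr1 ?ler0n//.
  by rewrite natrM.
apply: (@le_trans _ _ (2 * expR (- (ln 2 * N.+1%:R)))).
  by rewrite expRN expRM_natr lnK ?posrE// exprS invfM mulrA mulfV// mul1r exprVn.
rewrite ler_pM2l// ler_expR mulNr lerN2 mulrAC -mulrA ler_wpM2l ?ln_ge0 ?ler1n//.
by rewrite ler_pdivrMr// mulrC.
Qed.

Theorem theorem3 (R : realType) (d : nat) (d_gt0 : (0 < d)%N)
    (a b : 'rV[R]_d) (r : R) (r_gt1 : 1 < r) (Ck : R) (Ck_gt0 : 0 < Ck) :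
  exists C1 c1 : R, 0 < c1 /\
  forall (Omega : set 'rV[R]_d)
    (m : nat) (c : {ffun 'I_d -> 'I_m.+1} -> 'rV[R]_d -> R)
    (sigma : R -> R)
    (mu : probability (borel 'rV[R]_d) R)
    (rho : probability (borel (params R d)) R),
  let k := residual_kernel c sigma rho in
  let T := integral_op Omega mu k in
  (* Omega is a bounded domain contained in the box D *)
  open Omega -> connected Omega -> Omega !=set0 -> bounded_set Omega ->
  Omega `<=` box a b ->
  (* mu is supported on Omega *)
  mu Omega = 1%E ->
  (* standing assumptions on L, sigma, rho *)
  (forall alpha, measurable_fun (Omega : set (borel 'rV[R]_d)) (c alpha)) ->
  measurable_fun setT sigma ->
  bounded_set (law_support rho) ->
  (forall n t, (n < m)%N -> affine_image Omega rho t ->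
    derivable (derive1n n sigma) t 1) ->
  (forall n, (n <= m)%N ->
    [bounded derive1n n sigma t | t in affine_image Omega rho]) ->
  (ereal_sup [set \int[mu]_(x in Omega) ((zeta c sigma theta x) ^+ 2)%:E
             | theta in law_support rho] < +oo)%E ->
  (* T <> 0 on L^2(mu) *)
  (exists2 v, v \in Lfun mu 2%:E & ~ (T v = cst 0 %[ae mu])) ->
  (* bounded analytic extension of the kernel to the polyellipse *)
  (forall x', Omega x' ->
    bounded_analytic_extension Omega (polyellipse a b r) Ck (k ^~ x')) ->
  forall tau : R^nat, eigenvalue_seq mu T tau ->
  tau 0%N <= C1 /\
  forall j, (1 <= j)%N ->
    tau j.-1 <= C1 * expR (- c1 * (j%:R `^ (d%:R)^-1)).
Proof.
have [M hM] := fine_mesh 4 r_gt1.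
exists (2 * Ck), (ln 2 / M.+1%:R); split.
  by rewrite divr_gt0 ?ln_gt0 ?ltr1n// ltr0n.
move=> Omega m c sigma mu rho k T oO _ O0 _ Obox muO _ _ _ _ _ _ _ kext tau taueig.
have ab := open_box_lt oO O0 Obox.
have mO : measurable (Omega : set (borel 'rV[R]_d)) by exact: sub_sigma_algebra.
have ksym x y : k x y = k y x.
  by congr (fine ('E_rho[_])); apply/funext => theta; rewrite mulrC.
have kK x y : Omega x -> Omega y -> `|k x y| <= Ck.
  by move=> Ox Oy; exact: (bounded_extension_le ab r_gt1 Obox (kext y Oy)).
have kstep e := kernel_step_approximation ab r_gt1 Ck_gt0 O0 Obox kext (e := e).
(* rho = 4, so each further order of the Taylor polynomials halves the error. *)
have tau_le N n : ((M.+1 * N) ^ d <= n)%N -> tau n <= Ck * 2^-1 ^+ N.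
  move=> Nn; have [B HB] := cell_monomial_bounded a b M N.
  pose J := ({ffun 'I_d -> 'I_M.+1} * {ffun 'I_d -> 'I_N})%type.
  have halfE : 2 / 4 = 2^-1 :> R by field.
  apply: (@eigenvalue_le_approximation _ (borel 'rV[R]_d) _ mu Omega mO muO k Ck
    ksym kK kstep tau J (fun p => cell_monomial a b p.1 p.2) B) => //.
  - by rewrite mulr_ge0 ?exprn_ge0 ?invr_ge0// ltW.
  - by move=> p; apply: measurable_funTS; exact: measurable_cell_monomial.
  - move=> y Oy.
    have [|s hs] := cell_approximation N ab r_gt1 (rho := 4) _ hM Obox (kext y Oy).
      by rewrite ler1n.
    exists (fun p : J => s p.1 p.2) => x Ox; rewrite -halfE.
    by have := hs x Ox; rewrite pair_bigA.
  - by rewrite card_prod !card_ffun !card_ord -expnMn.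
split.
  have := tau_le 0%N 0%N; rewrite muln0 exp0n// expr0 mulr1 => /(_ isT).
  by move=> /le_trans; apply; rewrite ler_peMl ?ler1n// ltW.
move=> [//|j] _ /=; have [N /andP[Nj jN]] := nat_power_bracket j d_gt0 (ltn0Sn M).
apply: le_trans (tau_le N j Nj) _.
by rewrite [2 * Ck]mulrC -mulrA ler_wpM2l ?(ltW Ck_gt0)// exponential_rate.
Qed.
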